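(* Let $\theta>0$ and let $\mathcal{L}$ be the uniform distribution on the unit circle. For all $x\ge0$, let $G(x)$ be the probability that the point process $\tau_\infty(\theta,\mathcal{L})$ has no point in the interval $(0,x)$, and for all $x\in\mathbb{R}$ set $$H(x):=\mathbf{1}_{x>0}\,x^{\theta-1}G(x).$$ Then $H$ is integrable and satisfies the equation $$xH(x)=\theta\int_0^1(1-y)H(x-y)\,dy.$$ Moreover, if the Fourier transform $\widehat H$ of $H$ is given by $\widehat H(\lambda)=\int_{-\infty}^\infty e^{-i\lambda x}H(x)\,dx$, then it satisfies $$\widehat H(\lambda)=\widehat H(0)\exp\left(-i\theta\int_0^\lambda\frac{1-e^{-i\mu}-i\mu}{\mu^2}\,d\mu\right)$$ for all $\lambda\in\mathbb{R}$.
   Context: For $\mathcal{L}$ uniform on the unit circle, $\tau_\infty(\theta,\mathcal{L})$ is the random point measure on $\mathbb{R}$ $$\tau_\infty(\theta,\mathcal{L})=\sum_{m=1}^\infty\sum_{k\in\mathbb{Z}}\delta_{(k+\chi_m)/x_m},$$ where $(x_m)_{m\ge1}$ is a Poisson-Dirichlet process of parameter $\theta$ and $(\chi_m)_{m\ge1}$ is an independent sequence of i.i.d. uniform random variables on $[0,1)$. (A Poisson-Dirichlet process of parameter $\theta$ has the law of the decreasing rearrangement of the GEM($\theta$) sequence $y_m=V_m\prod_{i<m}(1-V_i)$, with $(V_i)$ i.i.d. of density $\theta(1-x)^{\theta-1}$ on $(0,1)$.) *)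

(* Defs.v *)
From HB Require Import structures.
From mathcomp Require Import all_boot all_order all_algebra finmap.
From mathcomp Require Import all_classical all_reals all_analysis.
From mathcomp Require Import complex.

Set Implicit Arguments.
Unset Strict Implicit.
Unset Printing Implicit Defensive.

Import Order.TTheory GRing.Theory Num.Theory.
Import numFieldNormedType.Exports.

Local Open Scope classical_set_scope.
Local Open Scope ring_scope.

Section RandomVariables.
Context (R : realType).

Definition has_density (d : measure_display) (T : measurableType d)
    (P : probability T R) (X : {RV P >-> R}) (D : set R) (f : R -> R) : Prop :=
  forall A : set R, measurable A ->
    distribution P X A = (\int[lebesgue_measure]_(t in A `&` D) (f t)%:E)%E.

Definition mutually_independent (d : measure_display) (T : measurableType d)
    (P : probability T R) (X : nat -> {RV P >-> R}) : Prop :=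
  forall (J : {fset nat}) (A : nat -> set R), (forall i, measurable (A i)) ->
    P (\bigcap_(i in [set` J]) (X i @^-1` A i)) =
    (\prod_(i <- J) P (X i @^-1` A i))%E.

(* The product sigma-algebra on the space of real sequences, generated by the
   coordinate projections. *)
Definition seq_measurable : set (set (nat -> R)) :=
  <<s \bigcup_(m in [set: nat])
        preimage_set_system [set: nat -> R] (fun u => u m) measurable >>.

Definition random_seq (d : measure_display) (T : measurableType d)
    (P : probability T R) (X : nat -> {RV P >-> R}) : T -> (nat -> R) :=
  fun w m => X m w.

Definition same_law (d d' : measure_display) (T : measurableType d)
    (T' : measurableType d') (P : probability T R) (Q : probability T' R)
    (X : nat -> {RV P >-> R}) (Y : nat -> {RV Q >-> R}) : Prop :=
  forall A, seq_measurable A ->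
    P (random_seq X @^-1` A) = Q (random_seq Y @^-1` A).

Definition independent_seqs (d : measure_display) (T : measurableType d)
    (P : probability T R) (X Y : nat -> {RV P >-> R}) : Prop :=
  forall A B, seq_measurable A -> seq_measurable B ->
    P (random_seq X @^-1` A `&` random_seq Y @^-1` B) =
    (P (random_seq X @^-1` A) * P (random_seq Y @^-1` B))%E.

End RandomVariables.

(* Sequences are indexed from 0 instead of 1 throughout. *)
Section PoissonDirichlet.
Context (R : realType).

Definition gem (v : nat -> R) (m : nat) : R := v m * \prod_(i < m) (1 - v i).

Definition decreasing_rearrangement (y z : nat -> R) : Prop :=
  (forall m n, (m <= n)%N -> z n <= z m) /\
  exists s : nat -> nat, bijective s /\ forall m, z m = y (s m).

(* The rearrangement exists only almost surely: it may fail on the null event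
   where some V i lies outside (0, 1) or the GEM weights do not tend to 0. *)
Definition poisson_dirichlet (theta : R) (d : measure_display)
    (T : measurableType d) (P : probability T R)
    (x : nat -> {RV P >-> R}) : Prop :=
  exists (d' : measure_display) (T' : measurableType d') (Q : probability T' R)
         (V z : nat -> {RV Q >-> R}),
    [/\ mutually_independent V,
        forall i, has_density (V i) `]0, 1[
                    (fun t => theta * (1 - t) `^ (theta - 1)),
        {ae Q, forall w, decreasing_rearrangement (gem (random_seq V w))
                           (random_seq z w)}
      & same_law x z].

Definition uniform01 (d : measure_display) (T : measurableType d)
    (P : probability T R) (X : {RV P >-> R}) : Prop :=
  has_density X `[0, 1[ (fun=> 1).

Definition tau_infty (x chi : nat -> R) (A : set R) : \bar R :=
  \esum_(p in [set: nat * int]) \d_((p.2%:~R + chi p.1) / x p.1) A.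

Definition gap_prob (d : measure_display) (T : measurableType d)
    (P : probability T R) (x chi : nat -> {RV P >-> R}) (t : R) : R :=
  fine (P [set w | tau_infty (random_seq x w) (random_seq chi w) `]0, t[
                   = 0%E]).

Definition H_fun (theta : R) (G : R -> R) (t : R) : R :=
  \1_(`]0, +oo[%classic) t * t `^ (theta - 1) * G t.

End PoissonDirichlet.

Section ComplexAnalysis.
Context (R : realType).

Definition expC (z : R[i]) : R[i] :=
  Complex (expR (complex.Re z) * cos (complex.Im z)) (expR (complex.Re z) * sin (complex.Im z)).

Definition Cintegral (D : set R) (f : R -> R[i]) : R[i] :=
  Complex (\int[lebesgue_measure]_(t in D) complex.Re (f t))
          (\int[lebesgue_measure]_(t in D) complex.Im (f t)).

Definition Cintegral_oriented (a b : R) (f : R -> R[i]) : R[i] :=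
  if a <= b then Cintegral `[a, b] f else - Cintegral `[b, a] f.

Definition fourier (H : R -> R) (l : R) : R[i] :=
  Cintegral setT (fun t => expC (- 'i%C * (l * t)%:C%C) * (H t)%:C%C).

End ComplexAnalysis.

(* Main.v *)
Require Import Defs.
From HB Require Import structures.
From mathcomp Require Import all_boot all_order all_algebra finmap.
From mathcomp Require Import all_classical all_reals all_analysis.
From mathcomp Require Import complex measurable_realfun.
From mathcomp Require Import ring lra.

Set Implicit Arguments.
Unset Strict Implicit.
Unset Printing Implicit Defensive.

Import Order.TTheory GRing.Theory Num.Theory.
Import numFieldNormedType.Exports.

Local Open Scope classical_set_scope.
Local Open Scope ring_scope.

(** Let [y] be the GEM sequence built from the variables [V], and let [chi] be
the independent uniform phases. For the [m]-th lattice [(k + chi_m) / x_m] the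
first point to the right of [0] is [chi_m / x_m], so [(0, t)] contains no
point almost surely exactly when [t * x_m <= chi_m] for all [m]. Only the law
of [x] matters, and the law of an i.i.d. sequence does not change under
permutations, so the decreasing rearrangement may be undone: [G t] is the
probability that [t * y_m <= chi_m] for all [m] ([tau_infty_gap],
[domination_prob_perm], [gap_probE]).

The GEM sequence reproduces itself: [y_0 = V_0], and the remaining weights are
[1 - V_0] times a GEM sequence built from the shifted [V]. An i.i.d. law is the
image of the product of the marginal and itself under the map that puts a
first term in front ([iid_law_cons]); applied to both [V] and [chi], this
gives [G t = E (max 0 (1 - t * V_0) * G (t * (1 - V_0)))] ([gem_gap_rec]).
With the density [theta * (1 - a) ^ (theta - 1)] of [V_0] and the substitution
[y = t a] the factor [t ^ (theta - 1)] in [H] absorbs the powers, which leaves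
the equation [t * H t = theta * int ramp y * H (t - y) dy], where [ramp y = 1
- y] on [[0, 1]] and [0] elsewhere ([H_fun_convolution]).

The rest uses only this equation, [H >= 0], [H t = 0] for [t <= 0] and the
finiteness of [int_0^N H], which holds because [G <= 1]
([H_fun_locally_integrable]). Integrating the equation against indicators
gives [int_0^N t H <= theta * int_0^N H]; on [t >= 2 theta] the left side is
at least [2 theta H], so the mass of [H] on [(0, N)] is at most twice its mass
on [(0, 2 theta)], for every [N] ([integral_H_below_le]). Hence [H] and [t H
t] are integrable, and the Fourier transform of [H] is differentiable with
derivative [-i] times the transform of [t H t], which by the convolution
equation is [theta] times the product of the transforms of [ramp] and [H]
([trig_convolution]). This linear differential equation is solved by the
exponential of a primitive of the transform of [ramp] ([fourier_solution]),
and that transform is [(1 - exp (-i m) - i m) / m ^ 2] ([cos_tr_ramp],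
[sin_tr_ramp]). Real and imaginary parts are treated as cosine and sine
transforms, and are put together at the end. *)

(** * The space of real sequences and i.i.d. laws on it *)

Section SequenceSpace.
Context {R : realType}.

(** The generator in [seq_measurable]; with a name it turns real sequences
into a measurable type. *)
Definition coordinate_sets : set (set (nat -> R)) :=
  \bigcup_(m in [set: nat])
    preimage_set_system [set: nat -> R] (fun u => u m) measurable.

Definition seq_space := g_sigma_algebraType coordinate_sets.
HB.instance Definition _ := Measurable.on seq_space.

(** The finite-dimensional cylinders form a pi-system that generates the
product sigma-algebra; measures are compared on them. *)
Definition box n (A : nat -> set R) : set seq_space :=
  [set u | forall i, (i < n)%N -> A i (u i)].

Lemma measurable_coordinate m : measurable_fun setT (fun u : seq_space => u m).
Proof.
move=> _ A mA; apply: sub_sigma_algebra; exists m => //=.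
by exists A.
Qed.

Lemma measurable_fun_seq d (T : measurableType d) (f : T -> seq_space) :
  (forall m, measurable_fun setT (fun w => f w m)) -> measurable_fun setT f.
Proof.
move=> mf; apply: (@measurability _ _ _ _ _ f coordinate_sets) => //.
move=> _ [_ [m _ [B mB <-]] <-].
rewrite setTI; have := mf m measurableT B mB; rewrite setTI.
by congr (measurable _); apply/seteqP; split => w /=; rewrite setTI.
Qed.

Lemma measurable_box n A : (forall i, measurable (A i)) -> measurable (box n A).
Proof.
move=> mA.
have -> : box n A = \bigcap_(i in [set i | (i < n)%N]) ((fun u : seq_space =>
    u i) @^-1` A i).
  by apply/seteqP; split.
apply: bigcap_measurableType => //= i _.
by have := measurable_coordinate i measurableT (mA i); rewrite setTI.
Qed.

(** A single coordinate constraint is a cylinder with all the other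
constraints set to the full line. *)
Lemma box_generate : @measurable _ seq_space =
  <<s [set B | exists n A, (forall i, measurable (A i)) /\ B = box n A] >>.
Proof.
apply/seteqP; split; last first.
  apply: smallest_sub; first exact: smallest_sigma_algebra.
  by move=> _ [n [A [mA ->]]]; exact: measurable_box.
apply: smallest_sub; first exact: smallest_sigma_algebra.
move=> _ [m _ [B mB <-]]; apply: sub_sigma_algebra.
exists m.+1, (fun i => if i == m then B else setT); split.
  by move=> i; case: ifP.
rewrite setTI; apply/seteqP; split => u /=.
  by move=> Bu i _; case: ifP => // /eqP ->.
by move=> /(_ m (ltnSn m)); rewrite eqxx.
Qed.

Lemma seq_measure_unique (mu nu : probability seq_space R) :
  (forall n A, (forall i, measurable (A i)) -> mu (box n A) = nu (box n A)) ->
  forall B, measurable B -> mu B = nu B.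
Proof.
move=> munu B mB.
apply: (measure_unique [set B | exists n A, (forall i, measurable (A i)) /\ B = box n A]
  (fun=> setT)) => //.
- exact: box_generate.
- move=> _ _ [n [A [mA ->]]] [m [A' [mA' ->]]].
  exists (maxn n m), (fun i =>
      (if (i < n)%N then A i else setT) `&` (if (i < m)%N then A' i else setT)).
  split; first by move=> i; apply: measurableI; case: ifP.
  apply/seteqP; split => u /=.
    move=> [H1 H2] i; rewrite leq_max => /orP[] im.
      by split; [rewrite im; exact: H1|case: ifP => // /H2].
    by split; [case: ifP => // /H1|rewrite im; exact: H2].
  move=> H; split => i im.
    by have [] := H i; [rewrite leq_max im|rewrite im].
  by have [] := H i; [rewrite leq_max im orbT|rewrite im].
- by move=> _; exists 0%N, (fun=> setT); split => //; apply/seteqP; split => u.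
- by rewrite bigcup_const//; exists 0%N.
- by move=> _ [n [A [mA ->]]]; exact: munu.
- by move=> _; rewrite (@le_lt_trans _ _ 1%E) ?ltry// probability_le1.
Qed.

Definition iid_law (mu0 : probability R R) (mu : probability seq_space R) : Prop :=
  forall n A, (forall i, measurable (A i)) ->
    mu (box n A) = (\prod_(i < n) mu0 (A i))%E.

Lemma iid_law_unique mu0 mu nu : iid_law mu0 mu -> iid_law mu0 nu ->
  forall B, measurable B -> mu B = nu B.
Proof.
by move=> hmu hnu; apply: seq_measure_unique => n A mA; rewrite hmu// hnu.
Qed.

Definition seq_cons (au : R * seq_space) : seq_space :=
  fun i => if i is j.+1 then au.2 j else au.1.

Lemma measurable_seq_cons : measurable_fun setT seq_cons.
Proof.
apply: measurable_fun_seq => -[|m] /=; first exact: measurable_fst.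
by apply: (measurableT_comp (measurable_coordinate m)); exact: measurable_snd.
Qed.

HB.instance Definition _ := isMeasurableFun.Build _ _ _ _ seq_cons measurable_seq_cons.

(** Self-similarity of i.i.d. sequences: a first term with the marginal law,
independent of an i.i.d. tail, is again i.i.d. Both sides agree on cylinders.
All the renewal structure of the GEM sequence comes from this. *)
Lemma iid_law_cons mu0 mu : iid_law mu0 mu -> forall B, measurable B ->
  mu B = (mu0 \x mu)%E (seq_cons @^-1` B).
Proof.
move=> hmu B mB.
pose nu : probability seq_space R := distribution (mu0 \x mu)%E seq_cons.
apply: (@iid_law_unique mu0 mu nu) => // -[|n] A mA.
  rewrite big_ord0 (_ : box 0 A = setT) ?probability_setT//.
  by apply/seteqP; split => // u _ i; rewrite ltn0.
rewrite big_ord_recl -(hmu _ (A \o succn))//= -product_measure1E//; last first.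
  by apply: measurable_box => i; exact: mA.
congr (_ _); apply/seteqP; split => -[a u] /=.
  by move=> H; split; [exact: (H 0%N)|move=> i /= im; exact: (H i.+1)].
by move=> [/= ? H] [|i] //= im; exact: H.
Qed.

End SequenceSpace.

Section RandomSequences.
Context {R : realType} {d : measure_display} {T : measurableType d}
  {P : probability T R}.

(** [random_seq] with the sigma-algebra of [seq_space] on its codomain, so
that it is a random element. *)
Definition seq_rv (X : nat -> {RV P >-> R}) : T -> @seq_space R := random_seq X.

Lemma measurable_seq_rv (X : nat -> {RV P >-> R}) : measurable_fun setT (seq_rv X).
Proof. by apply: measurable_fun_seq => m; exact: measurable_funP. Qed.

HB.instance Definition _ (X : nat -> {RV P >-> R}) :=
  isMeasurableFun.Build _ _ _ _ (seq_rv X) (measurable_seq_rv X).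

Definition seq_law (X : nat -> {RV P >-> R}) : probability (@seq_space R) R :=
  distribution P (seq_rv X).

(** An i.i.d. sequence read through an injective reindexing [s] is i.i.d. with
the same law: the constraint on index [i] becomes one on index [s i], and [r]
recovers [i] from it. *)
Lemma iid_law_reindex (mu0 : probability R R) (X : nat -> {RV P >-> R})
    (s r : nat -> nat) : cancel s r ->
    mutually_independent X ->
    (forall i A, measurable A -> P (X i @^-1` A) = mu0 A) ->
  iid_law mu0 (seq_law (X \o s)).
Proof.
move=> sr indX lawX n A mA.
have := indX [fset s i | i in iota 0 n]%fset (A \o r) (fun i => mA (r i)).
rewrite big_imfset /=; last by move=> i j _ _; exact: (can_inj sr).
rewrite undup_id ?iota_uniq// -[X in iota 0 X]subn0 -/(index_iota 0 n) big_mkord.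
rewrite (eq_bigr (fun i : 'I_n => mu0 (A i))); last first.
  by move=> i _; rewrite /= sr; exact: lawX.
move=> <-; congr (P _); apply/seteqP; split => w /=.
  move=> H _ /= /imfsetP[i /= +] ->; rewrite mem_iota subn0 /= sr; exact: H.
move=> H i im; have := H (s i); rewrite /= sr; apply.
by apply/imfsetP; exists i => //=; rewrite mem_iota subn0.
Qed.

End RandomSequences.

(** * Pointwise domination of one sequence by another *)

Section Domination.
Context {R : realType}.
Local Notation S := (@seq_space R).
Implicit Types (mu nu : probability S R).

Definition dominated_pairs : set (S * S) := [set uc | forall m, uc.1 m <= uc.2 m].

Lemma measurable_dominated_pairs : measurable dominated_pairs.
Proof.
have -> : dominated_pairs = \bigcap_m [set uc : S * S | uc.1 m <= uc.2 m].
  by apply/seteqP; split => uc /= H; [move=> m _; exact: H|move=> m; exact: (H m)].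
apply: bigcap_measurableType => m _.
have m1 : measurable_fun setT (fun uc : S * S => uc.1 m).
  exact: (measurableT_comp (measurable_coordinate m) measurable_fst).
have m2 : measurable_fun setT (fun uc : S * S => uc.2 m).
  exact: (measurableT_comp (measurable_coordinate m) measurable_snd).
by have := measurable_fun_ler m1 m2 measurableT (Logic.I : measurable [set true]);
    rewrite setTI.
Qed.

(** When [mu] is the law of the phases, this is the probability that a gap
survives given the weights [u], already multiplied by the length of the gap.
*)
Definition domination_prob mu (u : S) : \bar R := mu [set c | forall m, u m <= c m].

Lemma domination_probE mu u :
  domination_prob mu u = mu (xsection dominated_pairs u).
Proof. by congr (mu _); apply/seteqP; split => c /=; rewrite /xsection /= inE. Qed.

Lemma measurable_domination_set (u : S) :
  measurable [set c : S | forall m, u m <= c m].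
Proof.
rewrite (_ : [set c | _] = xsection dominated_pairs u).
  by apply: measurable_xsection; exact: measurable_dominated_pairs.
by apply/seteqP; split => c /=; rewrite /xsection /= inE.
Qed.

Lemma measurable_domination_prob mu : measurable_fun setT (domination_prob mu).
Proof.
rewrite (_ : domination_prob mu = mu \o xsection dominated_pairs).
  by apply: measurable_fun_xsection; exact: measurable_dominated_pairs.
by apply/funext => u; rewrite domination_probE.
Qed.

Lemma domination_prob_ge0 mu u : (0 <= domination_prob mu u)%E.
Proof. exact: measure_ge0. Qed.

Lemma domination_prob_le1 mu u : (domination_prob mu u <= 1)%E.
Proof. by apply: probability_le1; exact: measurable_domination_set. Qed.

(** The constraint on the first term is independent of the constraints on the
tail, and the tail has the same law as the whole sequence. *)
Lemma domination_prob_cons (mu0 : probability R R) mu a u : iid_law mu0 mu ->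
  domination_prob mu (seq_cons (a, u)) = (mu0 `[a, +oo[%classic * domination_prob mu u)%E.
Proof.
move=> hmu; rewrite /domination_prob (iid_law_cons hmu); last first.
  exact: measurable_domination_set.
rewrite -product_measure1E//; last exact: measurable_domination_set.
congr (_ _); apply/seteqP; split => -[c0 c] /=.
  by move=> H; split; [rewrite in_itv/= andbT; exact: (H 0%N)|move=> m; exact: (H m.+1)].
by rewrite in_itv/= andbT => -[a0 H] [|m] //=; exact: H.
Qed.

(** Stick breaking: after the first break [a], the remaining stick of length
[1 - a] is broken by the shifted variables. *)
Lemma gem_cons a (v : S) m :
  gem (seq_cons (a, v)) m = if m is j.+1 then (1 - a) * gem v j else a.
Proof.
case: m => [|m]; rewrite /gem /=; first by rewrite big_ord0 mulr1.
by rewrite big_ord_recl /= mulrCA.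
Qed.

Lemma measurable_gem m : measurable_fun setT (fun v : S => gem v m).
Proof.
apply: measurable_funM; first exact: measurable_coordinate.
apply: measurable_prod => i _.
by apply: measurable_funB => //; exact: measurable_coordinate.
Qed.

Definition scaled_gem (tv : R * S) : S := fun m => tv.1 * gem tv.2 m.

Lemma measurable_scaled_gem : measurable_fun setT scaled_gem.
Proof.
apply: measurable_fun_seq => m; apply: measurable_funM => //.
exact: (measurableT_comp (measurable_gem m) measurable_snd).
Qed.

Lemma scaled_gem_cons t a v :
  scaled_gem (t, seq_cons (a, v)) = seq_cons (t * a, scaled_gem (t * (1 - a), v)).
Proof.
apply/funext => m; rewrite /scaled_gem /= gem_cons; case: m => //= m.
by rewrite mulrA.
Qed.

(** Probability that an interval of length [t] is free of points when the
weights are the GEM sequence of [v] drawn from [mu] and the phases have law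
[nu]. *)
Definition gem_gap mu nu (t : R) : \bar R :=
  \int[mu]_v domination_prob nu (scaled_gem (t, v)).

Lemma measurable_gem_gap mu nu : measurable_fun setT (gem_gap mu nu).
Proof.
apply: (@measurable_fun_fubini_tonelli_F _ _ _ _ _ _
  (fun tv => domination_prob nu (scaled_gem tv))).
  exact: (measurableT_comp (measurable_domination_prob nu) measurable_scaled_gem).
by move=> tv; exact: domination_prob_ge0.
Qed.

Lemma gem_gap_ge0 mu nu t : (0 <= gem_gap mu nu t)%E.
Proof. by apply: integral_ge0 => v _; exact: domination_prob_ge0. Qed.

Lemma measurable_domination_scaled nu t :
  measurable_fun setT (fun v => domination_prob nu (scaled_gem (t, v))).
Proof.
apply: (measurableT_comp (measurable_domination_prob nu)).
by apply: (measurableT_comp measurable_scaled_gem).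
Qed.

Lemma gem_gap_le1 mu nu t : (gem_gap mu nu t <= 1)%E.
Proof.
apply: (@le_trans _ _ (\int[mu]_v cst 1 v)%E).
  apply: ge0_le_integral => //.
  - exact: measurable_domination_scaled.
  - by move=> v _; exact: domination_prob_le1.
by rewrite integral_cst//= mul1e probability_le1.
Qed.

(** Condition on the first stick and on the first phase; what is left is the
same problem on a gap shortened by the factor [1 - a]. *)
Lemma gem_gap_rec (mu0 nu0 : probability R R) mu nu t : iid_law mu0 mu ->
    iid_law nu0 nu ->
  gem_gap mu nu t = (\int[mu0]_a (nu0 `[(t * a)%R,
      +oo[%classic * gem_gap mu nu (t * (1 - a))))%E.
Proof.
move=> hmu hnu.
have mf : measurable_fun setT (fun v => domination_prob nu (scaled_gem (t, v))).
  exact: measurable_domination_scaled.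
rewrite /gem_gap.
transitivity (\int[distribution (mu0 \x mu)%E seq_cons]_v
    domination_prob nu (scaled_gem (t, v)))%E.
  by apply: eq_measure_integral => B mB _; exact: (iid_law_cons hmu).
rewrite ge0_integral_distribution//.
rewrite fubini_tonelli1//; last first.
  by apply: measurableT_comp => //; exact: measurable_seq_cons.
apply: eq_integral => a _; rewrite /fubini_F/=.
under eq_integral do rewrite scaled_gem_cons (domination_prob_cons _ _ hnu).
by rewrite ge0_integralZl//; exact: measurable_domination_scaled.
Qed.

End Domination.

(** * The gap event of the point process *)

Section Gap.
Context {R : realType}.
Local Notation S := (@seq_space R).

Lemma ae_measure_eq d (T : measurableType d) (mu : {measure set T -> \bar R}) A B :
  measurable A -> measurable B -> {ae mu, forall w, A w <-> B w} -> mu A = mu B.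
Proof.
move=> mA mB AB.
rewrite -[A]setIT -[B]setIT -!integral_indic//; apply: ae_eq_integral => //.
- exact/measurable_EFinP/measurable_indic.
- exact/measurable_EFinP/measurable_indic.
- by apply: filterS AB => w /= [h1 h2] _;
    rewrite /= !indicE (_ : (w \in A) = (w \in B))//; apply/idP/idP; rewrite !inE.
Qed.

Lemma tau_infty_eq0 (u c : nat -> R) (A : set R) :
  tau_infty u c A = 0%E <-> forall m (k : int), ~ A ((k%:~R + c m) / u m).
Proof.
split=> [tau0 m k Amk|nA].
  suff : (1 <= tau_infty u c A)%E by rewrite tau0 lee_fin ler10.
  apply: esum_ge; exists [set (m, k)]; first by split.
  by rewrite fsbig_set1 /= diracE mem_set.
by apply: esum1 => -[m k] _ /=; rewrite diracE memNset//; exact: nA.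
Qed.

(** The points of one lattice are spaced by [1 / u m], so only the one with [k
= 0] is the first positive one. When [u m = 0] every quotient is [0], which is
not in the open interval, and the inequality on the right is automatic. *)
Lemma tau_infty_gap (u c : nat -> R) (t : R) : 0 < t ->
    (forall m, 0 <= u m) -> (forall m, 0 < c m < 1) ->
  tau_infty u c `]0, t[ = 0%E <-> forall m, t * u m <= c m.
Proof.
move=> t0 u0 c01; rewrite tau_infty_eq0; split=> [H m|H m k].
  have := u0 m; rewrite le_eqVlt => /predU1P[<-|um0].
    by rewrite mulr0; case/andP: (c01 m) => /ltW.
  have := H m 0; rewrite /= in_itv/= add0r => /negP.
  rewrite divr_gt0//=; last by case/andP: (c01 m).
  by rewrite -leNgt ler_pdivlMr.
rewrite /= in_itv/=; apply/negP.
have := u0 m; rewrite le_eqVlt => /predU1P[<-|um0].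
  by rewrite invr0 mulr0 ltxx.
rewrite ltr_pdivrMr// pmulr_lgt0 ?invr_gt0//; apply/negP => /andP[kc0 kct].
case/andP: (c01 m) => c0 c1.
have k0 : 0 <= k.
  by rewrite -[0]/(-1 + 1 : int) lezD1 -(ltr_int R) rmorphN1; lra.
have : (0 : R) <= k%:~R by rewrite ler0z.
have := H m; lra.
Qed.

(** Division is avoided: for [t > 0] the quotient lies in the gap iff [k + C]
lies strictly between [0] and [t * X], in the order given by the sign of [X].
*)
Lemma measurable_gap_event d (T : measurableType d) (X C : nat -> T -> R) t : 0 < t ->
    (forall m, measurable_fun setT (X m)) -> (forall m, measurable_fun setT (C m)) ->
  measurable [set w | tau_infty (fun m => X m w) (fun m => C m w) `]0, t[ = 0%E].
Proof.
move=> t0 mX mC.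
(* countably many conditions: the integers are split by constructor *)
pose E m (k : int) := [set w | ~ (`]0, t[%classic : set R) ((k%:~R + C m w) / X m w)].
have mE m k : measurable (E m k).
  have -> : E m k = ~` ([set w | 0 < k%:~R + C m w] `&` [set w | k%:~R + C m w < t *
      X m w]
      `|` [set w | k%:~R + C m w < 0] `&` [set w | t * X m w < k%:~R + C m w]).
    apply/seteqP; split => w; rewrite /E /= in_itv/=.
      move=> nE [[h1 h2]|[h1 h2]]; apply: nE.
        have X0 : 0 < X m w by rewrite -(pmulr_rgt0 _ t0); exact: lt_trans h1 h2.
        by rewrite divr_gt0//= ltr_pdivrMr.
      have X0 : X m w < 0 by rewrite -(pmulr_rlt0 _ t0); exact: lt_trans h2 h1.
      by rewrite nmulr_lgt0 ?invr_lt0// h1 ltr_ndivrMr.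
    move=> nE /andP[]; have [X0|X0|->] := ltgtP (X m w) 0.
    - by rewrite nmulr_lgt0 ?invr_lt0// ltr_ndivrMr// => ? ?; apply: nE; right.
    - by rewrite pmulr_lgt0 ?invr_gt0// ltr_pdivrMr// => ? ?; apply: nE; left.
    - by rewrite invr0 mulr0 ltxx.
  have mkC : measurable_fun setT (fun w => k%:~R + C m w) by apply: measurable_funD.
  have mtX : measurable_fun setT (fun w => t * X m w) by apply: measurable_funM.
  have mlt f g : measurable_fun setT f -> measurable_fun setT g ->
      measurable [set w : T | (f w : R) < g w].
    move=> mf mg; have := measurable_fun_ltr mf mg measurableT (Logic.I : measurable
        [set true]).
    by rewrite setTI.
  by apply: measurableC; apply: measurableU; apply: measurableI; exact: mlt.
rewrite (_ : [set w | _] = \bigcap_m ((\bigcap_n E m (Posz n)) `&` (\bigcap_n E m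
    (Negz n)))).
  apply: bigcapT_measurable => m.
  by apply: measurableI; exact: bigcapT_measurable.
apply/seteqP; split => w /=; rewrite tau_infty_eq0.
  by move=> H m _; split => n _; exact: H.
by move=> H m [n|n]; have [h1 h2] := H m Logic.I; [exact: h1|exact: h2].
Qed.

Section marginals.
Context d (T : measurableType d) (P : probability T R).

Lemma has_density_ae (X : {RV P >-> R}) D f : measurable D ->
  has_density X D f -> {ae P, forall w, D (X w)}.
Proof.
move=> mD /(_ (~` D) (measurableC mD)); rewrite setICl integral_set0 => X0.
exists (X @^-1` (~` D)); split => //.
by rewrite -[X in measurable X]setTI; apply: measurable_funP => //; exact: measurableC.
Qed.

Lemma uniform01_tail (X : {RV P >-> R}) (b : R) : uniform01 X -> 0 <= b ->
  distribution P X `[b, +oo[ = (Num.max 0 (1 - b))%:E.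
Proof.
move=> hX b0; rewrite hX//.
rewrite integral_cst//; last exact: measurableI.
rewrite mul1e (_ : _ `&` _ = `[b, 1[%classic).
  rewrite /= lebesgue_measure_itv/= lte_fin; case: ltP => b1.
    by rewrite EFinN -EFinB max_r// subr_ge0 ltW.
  by rewrite max_l// subr_le0.
apply/seteqP; split => r /=; rewrite !in_itv/= ?andbT.
  by move=> [-> /andP[_ ->]].
by move=> /andP[br ->]; rewrite br (le_trans b0 br).
Qed.

(** The endpoint [0] has to be excluded, because a phase equal to [0] puts a
point at the origin and the next one at [1 / x_m]. *)
Lemma uniform01_ae (X : {RV P >-> R}) : uniform01 X -> {ae P, forall w, 0 < X w < 1}.
Proof.
move=> hX; have X01 := has_density_ae (measurable_itv _) hX.
have X0 : {ae P, forall w, X w != 0}.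
  exists (X @^-1` [set 0]); split.
  - by rewrite -[X in measurable X]setTI; exact: measurable_funP.
  - have := hX [set 0] (measurable_set1 0); rewrite /distribution/pushforward => ->.
    rewrite (_ : _ `&` _ = [set 0]) ?integral_set1//.
    by apply/seteqP; split => r /= => [[]|->] //; rewrite in_itv/= lexx ltr01.
  - by move=> w /= /negP; rewrite negbK => /eqP.
by apply: filterS2 X01 X0 => w /=; rewrite in_itv/= => /andP[X0 ->];
    rewrite lt_neqAle X0 eq_sym => ->.
Qed.

End marginals.
End Gap.

(** * The gap probability in terms of the GEM sequence *)

Section GapOfGem.
Context {R : realType}.
Local Notation S := (@seq_space R).

Lemma same_density_law d (T : measurableType d) (P : probability T R)
    (X : nat -> {RV P >-> R}) D f : (forall i, has_density (X i) D f) ->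
  forall i A, measurable A -> P (X i @^-1` A) = distribution P (X 0%N) A.
Proof. by move=> Xf i A mA; rewrite [RHS](Xf 0%N)// -(Xf i). Qed.

Lemma iid_seq_law d (T : measurableType d) (P : probability T R)
    (X : nat -> {RV P >-> R}) D f :
    mutually_independent X -> (forall i, has_density (X i) D f) ->
  iid_law (distribution P (X 0%N)) (seq_law X).
Proof.
by move=> indX Xf; apply: (@iid_law_reindex _ _ _ _ _ X id id) => //;
    exact: same_density_law.
Qed.

(** Permuting the thresholds amounts to permuting the phases by the inverse,
which preserves their law. *)
Lemma domination_prob_perm d (T : measurableType d) (P : probability T R)
    (X : nat -> {RV P >-> R}) D f (s : nat -> nat) (u : S) :
    mutually_independent X -> (forall i, has_density (X i) D f) -> bijective s ->
  domination_prob (seq_law X) (fun m => u (s m)) = domination_prob (seq_law X) u.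
Proof.
move=> indX Xf [r sr rs].
have iidXs : iid_law (distribution P (X 0%N)) (seq_law (X \o s)).
  by apply: (iid_law_reindex sr) => //; exact: same_density_law.
rewrite {1}/domination_prob (iid_law_unique (iid_seq_law indX Xf) iidXs); last first.
  exact: measurable_domination_set.
congr (P _); apply/seteqP; split => w /=.
  by move=> H m; have := H (r m); rewrite /seq_rv /random_seq /= rs.
by move=> H m; exact: H.
Qed.

Lemma gem_ge0 (v : nat -> R) : (forall i, 0 < v i < 1) -> forall m, 0 <= gem v m.
Proof.
move=> v01 m; apply: mulr_ge0; first by case/andP: (v01 m) => /ltW.
by apply: prodr_ge0 => i _; case/andP: (v01 i) => _ /ltW; rewrite subr_ge0.
Qed.

Lemma measurable_seq_rv_pair d (T : measurableType d) (P : probability T R)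
    (x c : nat -> {RV P >-> R}) :
  measurable_fun setT (fun w => (seq_rv x w, seq_rv c w)).
Proof. by apply/measurable_fun_pairP; split; exact: measurable_seq_rv. Qed.

(** Independence is given on rectangles, which determine a measure on the
product. *)
Lemma independent_seqs_law d (T : measurableType d) (P : probability T R)
    (x c : nat -> {RV P >-> R}) : independent_seqs x c ->
  forall E : set (S * S), measurable E ->
  P [set w | E (seq_rv x w, seq_rv c w)] = (seq_law x \x seq_law c)%E E.
Proof.
move=> indep E mE.
pose xc : {mfun T >-> (S * S)%type} := HB.pack (fun w => (seq_rv x w, seq_rv c w))
  (isMeasurableFun.Build _ _ _ _ _ (measurable_seq_rv_pair x c)).
by rewrite (@product_measure_unique _ _ _ _ _ _ _ (distribution P xc)).
Qed.

(** The weights enter only through their law, so [x] can be replaced by the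
rearrangement [z] of the GEM sequence, and then by the GEM sequence itself. *)
Lemma gap_probE d (T : measurableType d) (P : probability T R)
    d' (T' : measurableType d') (Q : probability T' R)
    (x chi : nat -> {RV P >-> R}) (V z : nat -> {RV Q >-> R}) f t :
    (forall i, has_density (V i) `]0, 1[ f) ->
    {ae Q, forall w, decreasing_rearrangement (gem (random_seq V w)) (random_seq z w)} ->
    same_law x z ->
    (forall m, uniform01 (chi m)) -> mutually_independent chi ->
    independent_seqs x chi -> 0 < t ->
  (gap_prob x chi t)%:E = gem_gap (seq_law V) (seq_law chi) t.
Proof.
move=> Vf zV xz chi01 chiI xchi t0.
(* almost surely the sticks lie in (0, 1), so that all weights are nonnegative,
   and the phases lie in (0, 1) *)
have V01 : {ae Q, forall w, forall i, 0 < V i w < 1}.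
  apply: ae_foralln => i; have := has_density_ae (measurable_itv _) (Vf i).
  by apply: filterS => w; rewrite /= in_itv.
have mpos : measurable [set u : S | forall m, 0 <= u m].
  rewrite (_ : [set u | _] = \bigcap_m (fun u : S => u m) @^-1` `[0, +oo[).
    apply: bigcapT_measurable => m; rewrite -[X in measurable X]setTI.
    by apply: measurable_coordinate => //; exact: measurable_itv.
  apply/seteqP; split => u /= H m; first by rewrite /= in_itv/= H.
  by have := H m I; rewrite /= in_itv/= andbT.
have z0 : {ae Q, forall w, [set u : S | forall m, 0 <= u m] (seq_rv z w)}.
  apply: filterS2 V01 zV => w w01 [_ [s [_ zs]]] m.
  by rewrite /seq_rv zs; apply: gem_ge0.
have x0 : {ae P, forall w m, 0 <= x m w}.
  exists (seq_rv x @^-1` ~` [set u : S | forall m, 0 <= u m]); split => //.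
  - by rewrite -[X in measurable X]setTI; apply: measurable_seq_rv => //;
      exact: measurableC.
  - rewrite -[LHS]/(P (random_seq x @^-1` _)) xz; last first.
      exact: (measurableC mpos : measurable (~` [set u : S | forall m, 0 <= u m])).
    apply/measure_negligible => //.
    by rewrite -[X in measurable X]setTI; apply: measurable_seq_rv => //;
        exact: measurableC.
have chi_ae : {ae P, forall w m, 0 < chi m w < 1}.
  by apply: ae_foralln => m; exact: uniform01_ae.
pose E : set (S * S) := [set uc | dominated_pairs ((fun m => t * uc.1 m) : S, uc.2)].
have mE : measurable E.
  have mg : measurable_fun setT (fun uc : S * S => ((fun m => t * uc.1 m) : S, uc.2)).
    apply/measurable_fun_pairP; split => /=; last exact: measurable_snd.
    apply: measurable_fun_seq => m; apply: measurable_funM => //.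
    exact: (measurableT_comp (measurable_coordinate m) measurable_fst).
  by have := mg measurableT _ measurable_dominated_pairs; rewrite setTI.
have mscale : measurable_fun setT (fun u : S => (fun m => t * u m) : S).
  apply: measurable_fun_seq => m; apply: measurable_funM => //.
  exact: measurable_coordinate.
have mF : measurable_fun setT (fun u : S => domination_prob (seq_law chi) (fun m =>
    t * u m)).
  exact: (measurableT_comp (measurable_domination_prob (seq_law chi)) mscale).
have -> : (gap_prob x chi t)%:E = P [set w | E (seq_rv x w, seq_rv chi w)].
  rewrite /gap_prob fineK; last first.
    by apply: fin_num_measure; apply: measurable_gap_event => // m;
        exact: measurable_funP.
  apply: ae_measure_eq.
  - by apply: measurable_gap_event => // m; exact: measurable_funP.
  - by have := measurable_seq_rv_pair x chi measurableT mE; rewrite setTI.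
  - by apply: filterS2 x0 chi_ae => w xw cw; exact: tau_infty_gap.
rewrite independent_seqs_law//.
transitivity (\int[seq_law x]_u domination_prob (seq_law chi) (fun m => t * u m)%R)%E.
  apply: eq_integral => u _; rewrite domination_probE; congr (seq_law chi _);
     apply/seteqP; split => c; rewrite /xsection/= !inE.
(* only the law of the weights is known, so z takes the place of x here *)
transitivity (\int[seq_law z]_u domination_prob (seq_law chi) (fun m => t * u m)%R)%E.
  by apply: eq_measure_integral => A mA _; exact: xz.
rewrite ge0_integral_distribution// /gem_gap ge0_integral_distribution//; last first.
  exact: measurable_domination_scaled.
apply: ae_eq_integral => //.
- by apply: (measurableT_comp mF); exact: measurable_seq_rv.
- by apply: (measurableT_comp (measurable_domination_scaled _ _));
    exact: measurable_seq_rv.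
apply: filterS zV => w [_ [s [bs zs]]] _ /=.
rewrite -[RHS](domination_prob_perm _ chiI chi01 bs); congr domination_prob.
by apply/funext => m; rewrite /scaled_gem /= -zs.
Qed.

End GapOfGem.

(** * Integration against a density, and affine changes of variables *)

Section ChangeOfVariables.
Context {R : realType}.
Local Notation mu := (@lebesgue_measure R).
Local Open Scope ereal_scope.

(** The density is a Radon-Nikodym derivative of the law up to a null set, so
this is the change of measure formula. The law is first carried over to the
measurable structure of the Lebesgue measure, which has the same measurable
sets under another display. *)
Lemma integral_has_density d (T : measurableType d) (P : probability T R)
    (X : {RV P >-> R}) (D : set R) (f : R -> R) (phi : R -> \bar R) :
    measurable D -> measurable_fun D f -> (forall t, D t -> 0 <= f t)%R ->
    has_density X D f -> measurable_fun setT phi -> (forall t, 0 <= phi t) ->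
  \int[distribution P X]_t phi t = \int[mu]_(t in D) ((f t)%:E * phi t).
Proof.
move=> mD mf f0 Xf mphi phi0.
have mfE : measurable_fun D (EFin \o f) by exact/measurable_EFinP.
have mX : measurable_fun setT (X : T -> measurableTypeR R) 
  by have mX : measurable_fun setT X by exact: measurable_funP.
pose X' : {mfun T >-> measurableTypeR R} :=
  HB.pack (X : T -> measurableTypeR R) (isMeasurableFun.Build _ _ _ _ _ mX).
pose nu : probability (measurableTypeR R) R := distribution P X'.
have -> : \int[distribution P X]_t phi t = \int[nu]_t phi t.
  by rewrite !ge0_integral_distribution.
have dom : nu `<< mu.
  apply/null_content_dominatesP => A mA A0; rewrite [LHS]Xf// null_set_integral//.
  - exact: measurableI.
  - by apply: measurable_funS mfE.
  - by apply/eqP; rewrite -measure_le0 -A0 le_measure ?inE//; exact: measurableI.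
rewrite -(Radon_Nikodym_SigmaFinite.change_of_variables dom)//.
rewrite [RHS]integral_mkcond; apply: ae_eq_integral => //.
- apply: emeasurable_funM => //.
  exact: measurable_int (Radon_Nikodym_SigmaFinite.f_integrable dom).
- by apply/(measurable_restrictT _ _).1 => //; apply: emeasurable_funM => //;
    exact: measurable_funTS.
have RNf : ae_eq mu setT (Radon_Nikodym_SigmaFinite.f nu mu) ((EFin \o f) \_ D).
  apply: integral_ae_eq => //.
  - exact: Radon_Nikodym_SigmaFinite.f_integrable.
  - exact/(measurable_restrictT _ _).1.
  - move=> E _ mE; rewrite -Radon_Nikodym_SigmaFinite.f_integral// -integral_mkcondr.
    exact: Xf.
apply: filterS RNf => t /(_ Logic.I) -> _; rewrite !patchE; case: ifPn => _.
  by rewrite muleC.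
by rewrite mule0.
Qed.

(** Lebesgue measure is the image of itself under [t |-> c * t + b],
multiplied by [c], as can be seen on intervals. *)
Lemma integral_affine (c b : R) (phi : R -> \bar R) : (0 < c)%R ->
    measurable_fun setT phi -> (forall t, 0 <= phi t) ->
  \int[mu]_t phi t = c%:E * \int[mu]_t phi (c * t + b)%R.
Proof.
move=> c0 mphi phi0.
have maff : measurable_fun setT (fun t : measurableTypeR R =>
    (c * t + b)%R : measurableTypeR R).
  by apply: measurable_funD => //; exact: measurable_funM.
have -> : \int[mu]_t phi (c * t + b)%R =
    \int[pushforward mu (fun t : measurableTypeR R =>
        (c * t + b)%R : measurableTypeR R)]_t phi t.
  by rewrite ge0_integral_pushforward.
rewrite -[c]/((NngNum (ltW c0))%:num) -ge0_integral_mscale//.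
apply: eq_measure_integral => A mA _.
apply: lebesgue_measure_unique => // _ [[p q]] _ <-.
rewrite /= /mscale /= /pushforward.
rewrite (_ : _ @^-1` _ = `]((p - b) / c)%R, ((q - b) / c)%R]%classic); last first.
  by apply/seteqP; split => t /=;
      rewrite !in_itv/= ltr_pdivrMr// ler_pdivlMr// ltrBlDr lerBrDr mulrC.
rewrite !lebesgue_measure_itv/= !lte_fin ltr_pM2r ?invr_gt0// ltrD2r.
case: ltP => pq; last by rewrite mule0.
by rewrite -!EFinB -EFinM; congr (_%:E); field; rewrite gt_eqF.
Qed.

Lemma integral_opp (phi : R -> \bar R) :
    measurable_fun setT phi -> (forall t, 0 <= phi t) ->
  \int[mu]_t phi t = \int[mu]_t phi (- t)%R.
Proof.
move=> mphi phi0.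
transitivity (\int[pushforward mu (-%R : _ -> measurableTypeR R)]_t phi t).
  by apply: eq_measure_integral => A mA _; exact/esym/lebesgue_measureN.
by rewrite ge0_integral_pushforward.
Qed.

End ChangeOfVariables.

(** * From the size-biased recursion to the convolution equation *)

Section Convolution.
Context {R : realType}.
Local Notation mu := (@lebesgue_measure R).
Variables (theta : R) (k : R -> R).
Hypotheses (theta_gt0 : 0 < theta) (mk : measurable_fun setT k)
  (k_ge0 : forall t, 0 <= k t).
Local Notation H := (H_fun theta k).

Lemma H_fun_gt0 t : 0 < t -> H t = t `^ (theta - 1) * k t.
Proof. by move=> t0; rewrite /H_fun indicE mem_set ?mul1r//= in_itv/= t0. Qed.

Lemma H_fun_le0 t : t <= 0 -> H t = 0.
Proof. by move=> t0; rewrite /H_fun indicE memNset ?mul0r//= in_itv/= andbT;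
    apply/negP; rewrite -leNgt. Qed.

Lemma H_fun_ge0 t : 0 <= H t.
Proof. by rewrite /H_fun !mulr_ge0// ?powR_ge0// indicE. Qed.

Lemma measurable_H_fun : measurable_fun setT H.
Proof.
apply: measurable_funM => //; apply: measurable_funM; last exact: measurable_powR.
exact/measurable_indicP.
Qed.

Hypothesis k_rec : forall t, 0 < t -> (k t)%:E =
  (\int[mu]_(a in `]0%R, 1%R[)
     (theta * (1 - a) `^ (theta - 1) * (Num.max 0 (1 - t * a) * k (t * (1 - a))))%:E)%E.

(** Substitute [y = t * a]. The identity [(t - y) ^ (theta - 1) = t ^ (theta -
1) * (1 - a) ^ (theta - 1)] turns the density of the first stick into the
power in [H], and [max 0 (1 - t * a)] is the ramp [1 - y] on [0 <= y <= 1]. *)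
Lemma H_fun_convolution t :
  (t * H t)%:E = (theta%:E * \int[mu]_(y in `[0%R, 1%R]) ((1 - y) * H (t - y))%:E)%E.
Proof.
(* both sides vanish for t <= 0, since t - y <= 0 on [0, 1] *)
have [t0|t0] := leP t 0.
  rewrite H_fun_le0// mulr0 integral0_eq ?mule0// => y /=.
  by rewrite in_itv/= => /andP[y0 _]; rewrite H_fun_le0 ?mulr0//; lra.
have mF : measurable_fun setT (fun y : R => (1 - y) * H (t - y)).
  apply: measurable_funM; first exact: measurable_funB.
  by apply: (measurableT_comp measurable_H_fun); exact: measurable_funB.
have -> : (\int[mu]_(y in `[0%R, 1%R]) ((1 - y) * H (t - y))%:E =
    \int[mu]_y ((fun y => ((1 - y) * H (t - y))%:E) \_ `]0%R, 1%R]) y)%E.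
  rewrite -integral_mkcond integral_itv_obnd_cbnd//.
  by apply/measurable_EFinP; exact: measurable_funTS.
rewrite (@integral_affine _ t 0)//; last 2 first.
- apply/(measurable_restrictT _ _).1 => //.
  by apply/measurable_EFinP; exact: measurable_funTS.
- move=> y; rewrite patchE; case: ifPn => // /[!inE]/= /[!in_itv]/= /andP[_ y1].
  by rewrite lee_fin mulr_ge0 ?H_fun_ge0// subr_ge0.
rewrite H_fun_gt0// mulrA EFinM k_rec// integral_mkcond.
set g := (X in (_ * integral _ _ X = _)%E).
have mg : measurable_fun setT g.
  apply/(measurable_restrictT _ _).1 => //; apply/measurable_EFinP/measurable_funTS.
  apply: measurable_funM; apply: measurable_funM => //.
  - by apply: (measurableT_comp (measurable_powR _)); exact: measurable_funB.
  - by apply: measurable_maxr => //; apply: measurable_funB => //; exact: measurable_funM.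
  - by apply: measurableT_comp => //; apply: measurable_funM => //;
      exact: measurable_funB.
have g0 a : (0 <= g a)%E.
  rewrite /g patchE; case: ifPn => // _; rewrite lee_fin !mulr_ge0 ?(ltW theta_gt0)//.
    exact: powR_ge0.
  by rewrite le_max lexx.
transitivity (theta%:E * (t%:E * \int[mu]_a ((t `^ (theta - 1) / theta)%:E * g a)))%E.
  rewrite ge0_integralZl//; last by rewrite lee_fin divr_ge0// ?powR_ge0// ltW.
  rewrite !muleA -!EFinM; congr (_%:E * _)%E; field; exact: lt0r_neq0.
congr (_ * (_ * _))%E; apply: eq_integral => a _; rewrite addr0 /g !patchE.
have [a0|a0] := leP a 0.
  rewrite memNset ?mule0; last by rewrite /= in_itv/= (ltNge 0) a0.
  by rewrite memNset//= in_itv/= pmulr_rgt0// (ltNge 0) a0.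
have [a1|a1] := leP 1 a.
  rewrite memNset ?mule0; last by rewrite /= in_itv/= (ltNge a) a1 andbF.
  by case: ifPn => // _; rewrite H_fun_le0 ?mulr0// subr_le0 ler_peMr// ltW.
rewrite mem_set /=; last by rewrite in_itv/= a0.
have ta : t - t * a = t * (1 - a) by rewrite mulrBr mulr1.
have ta0 : 0 < t * (1 - a) by rewrite mulr_gt0// subr_gt0.
have [at1|at1] := leP (t * a) 1; last first.
  rewrite memNset ?max_l ?mul0r ?mulr0 ?mule0//; first by rewrite subr_le0 ltW.
  by rewrite /= in_itv/= (leNgt _ 1) at1 andbF.
rewrite mem_set/=; last by rewrite in_itv/= mulr_gt0.
rewrite max_r ?subr_ge0// ta H_fun_gt0// -EFinM; congr (_%:E).
rewrite powRM ?(ltW t0)//; last by rewrite subr_ge0 ltW.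
field; exact: lt0r_neq0.
Qed.

End Convolution.

Section LocalIntegrability.
Context {R : realType}.
Local Notation mu := (@lebesgue_measure R).
Variables (theta : R) (k : R -> R).
Hypotheses (theta_gt0 : 0 < theta) (mk : measurable_fun setT k)
  (k_ge0 : forall t, 0 <= k t) (k_le1 : forall t, k t <= 1).
Hypothesis beta_finite : (\int[mu]_(a in `]0%R, 1%R[)
  (theta * (1 - a) `^ (theta - 1))%:E < +oo)%E.
Local Notation H := (H_fun theta k).

(** Since [k <= 1], it suffices to integrate [t ^ (theta - 1)] over [(0, N)];
after [t = N * (1 - a)] this is a multiple of the total mass of the density.
*)
Lemma H_fun_locally_integrable (N : R) : 0 < N ->
  (\int[mu]_(t in `]0%R, N[) (H t)%:E < +oo)%E.
Proof.
move=> N0; pose phi : R -> \bar R := (fun y => (y `^ (theta - 1))%:E) \_ `]0%R, N[.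
have mphi : measurable_fun setT phi.
  apply/(measurable_restrictT _ _).1 => //; apply/measurable_EFinP/measurable_funTS.
  exact: measurable_powR.
have phi0 y : (0 <= phi y)%E.
  by rewrite /phi patchE; case: ifPn => // _; rewrite lee_fin powR_ge0.
apply: (@le_lt_trans _ _ (\int[mu]_t phi t)%E).
  rewrite /phi -integral_mkcond; apply: ge0_le_integral => //.
  - by move=> t _; rewrite lee_fin H_fun_ge0.
  - by apply/measurable_EFinP/measurable_funTS; exact: measurable_H_fun.
  - by apply/measurable_EFinP/measurable_funTS; exact: measurable_powR.
  - move=> t; rewrite /= in_itv/= => /andP[t0 _].
    by rewrite lee_fin H_fun_gt0// ler_piMr// powR_ge0.
rewrite integral_opp// (@integral_affine _ N (- N))//; last first.
  by apply: (measurableT_comp mphi).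
set g : R -> \bar R := fun a => (theta * (1 - a) `^ (theta - 1))%:E.
have mg : measurable_fun setT g.
  apply/measurable_EFinP; apply: measurable_funM => //.
  by apply: (measurableT_comp (measurable_powR _)); exact: measurable_funB.
have -> : (\int[mu]_a phi (- (N * a + - N))%R =
    \int[mu]_a ((N `^ (theta - 1) / theta)%:E * (g \_ `]0%R, 1%R[) a))%E.
  apply: eq_integral => a _; rewrite /phi !patchE.
  (* both sides vanish off 0 < a < 1 *)
  have -> : - (N * a + - N) = N * (1 - a) by ring.
  have -> : (N * (1 - a) \in `]0, N[%classic) = (a \in `]0, 1[%classic).
    apply/idP/idP; rewrite !inE/= !in_itv/= !pmulr_rgt0//.
      by move=> /andP[a1]; rewrite gtr_pMr// => a0; apply/andP; split; lra.
    by move=> /andP[a0 a1]; rewrite gtr_pMr//; apply/andP; split; lra.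
  case: ifPn => [|_]; last by rewrite mule0.
  rewrite inE/= in_itv/= => /andP[a0 a1]; rewrite /g -EFinM; congr (_%:E).
  rewrite powRM ?(ltW N0)//; last by rewrite subr_ge0 ltW.
  field; exact: lt0r_neq0.
rewrite ge0_integralZl//; last 3 first.
- exact/(measurable_restrictT _ _).1/measurable_funTS.
- move=> a _; rewrite patchE; case: ifPn => // _.
  by rewrite lee_fin mulr_ge0// ?powR_ge0// ltW.
- by rewrite lee_fin divr_ge0// ?powR_ge0// ltW.
rewrite -integral_mkcond; apply: lte_mul_pinfty; rewrite ?lee_fin ?(ltW N0)//.
by apply: lte_mul_pinfty; rewrite ?lee_fin ?divr_ge0 ?powR_ge0 ?(ltW theta_gt0).
Qed.

End LocalIntegrability.

(** * Integrability of solutions of the convolution equation *)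

Section Integrability.
Context {R : realType}.
Local Notation mu := (@lebesgue_measure R).

(** The convolution kernel, extended by zero to the line. *)
Definition ramp (y : R) : R := \1_(`[0%R, 1%R]%classic) y * (1 - y).

Lemma ramp_ge0 y : 0 <= ramp y.
Proof.
rewrite /ramp indicE; have [|_] := boolP (y \in _); last by rewrite mul0r.
by rewrite inE/= in_itv/= mul1r subr_ge0 => /andP[].
Qed.

Lemma ramp_neg y : y < 0 -> ramp y = 0.
Proof.
by move=> y0; rewrite /ramp indicE memNset ?mul0r//= in_itv/= (leNgt 0) y0.
Qed.

Lemma measurable_ramp : measurable_fun setT ramp.
Proof.
by apply: measurable_funM; [exact/measurable_indicP|exact: measurable_funB].
Qed.

Lemma integral_rampE (f : R -> R) :
  (\int[mu]_y (ramp y * f y)%:E = \int[mu]_(y in `[0%R, 1%R]) ((1 - y) * f y)%:E)%E.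
Proof.
rewrite [RHS]integral_mkcond; apply: eq_integral => y _.
by rewrite patchE /ramp indicE; case: ifPn => _; rewrite ?mul1r// !mul0r.
Qed.

Lemma integral_ramp_le1 : (\int[mu]_y (ramp y)%:E <= 1)%E.
Proof.
have -> : (\int[mu]_y (ramp y)%:E = \int[mu]_(y in `[0%R, 1%R]) (1 - y)%:E)%E.
  by under eq_integral do rewrite -[ramp _]mulr1; rewrite integral_rampE;
      under eq_integral do rewrite mulr1.
apply: (@le_trans _ _ (\int[mu]_(y in `[0%R, 1%R]) (cst 1 y))%E).
  apply: ge0_le_integral => //.
  - by move=> y; rewrite /= in_itv/= lee_fin subr_ge0 => /andP[].
  - by apply/measurable_EFinP/measurable_funTS; exact: measurable_funB.
  - by move=> y; rewrite /= in_itv/= lee_fin gerBl => /andP[].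
by rewrite integral_cst// mul1e /= lebesgue_measure_itv/= lte_fin ltr01 -EFinB subr0.
Qed.

Variables (theta : R) (H : R -> R).
Hypotheses (theta_gt0 : 0 < theta) (mH : measurable_fun setT H)
  (H_ge0 : forall t, 0 <= H t).
Hypothesis H_conv : forall t,
  (t * H t)%:E = (theta%:E * \int[mu]_y (ramp y * H (t - y))%:E)%E.

Lemma measurable_integral_shift (w : R -> R) :
    measurable_fun setT w -> (forall t, 0 <= w t) ->
  measurable_fun setT (fun y => \int[mu]_s (w (s + y) * H s)%:E)%E.
Proof.
move=> mw w0.
pose F (ys : measurableTypeR R * measurableTypeR R) : \bar R :=
  (w (ys.2 + ys.1) * H ys.2)%:E.
apply: (@measurable_fun_fubini_tonelli_F _ _ _ _ _ mu F); last first.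
  by move=> ys; rewrite lee_fin mulr_ge0.
apply/measurable_EFinP; apply: measurable_funM.
  apply: (measurableT_comp mw); apply: measurable_funD.
    exact: measurable_snd.
  exact: measurable_fst.
exact: (measurableT_comp mH measurable_snd).
Qed.

(** Tonelli applied to the convolution equation, followed by [t = s + y]. It
is stated for nonnegative weights; a bounded weight such as [cos] is reached
by adding a constant. *)
Lemma integral_weight (w : R -> R) : measurable_fun setT w -> (forall t, 0 <= w t) ->
  (\int[mu]_t (w t * (t * H t))%:E =
   theta%:E * \int[mu]_y ((ramp y)%:E * \int[mu]_s (w (s + y) * H s)%:E))%E.
Proof.
move=> mw w0.
have mHs y : measurable_fun setT (fun t : R => H (t - y)).
  by apply: (measurableT_comp mH); exact: measurable_funB.
have mtH t : measurable_fun setT (fun y : R => H (t - y)).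
  by apply: (measurableT_comp mH); exact: measurable_funB.
pose F (ty : measurableTypeR R * measurableTypeR R) : \bar R :=
  (w ty.1 * (ramp ty.2 * H (ty.1 - ty.2)))%:E.
have mF : measurable_fun setT F.
  apply/measurable_EFinP; apply: measurable_funM.
    exact: (measurableT_comp mw measurable_fst).
  apply: measurable_funM; first exact: (measurableT_comp measurable_ramp measurable_snd).
  apply: (measurableT_comp mH); apply: measurable_funB.
    exact: measurable_fst.
  exact: measurable_snd.
have F0 ty : (0 <= F ty)%E by rewrite lee_fin mulr_ge0// mulr_ge0// ramp_ge0.
transitivity (theta%:E * \int[mu]_t \int[mu]_y F (t, y))%E.
  rewrite -ge0_integralZl//; last 3 first.
  - exact: measurable_fun_fubini_tonelli_F.
  - by move=> t _; exact: integral_ge0.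
  - by rewrite lee_fin ltW.
  apply: eq_integral => t _; rewrite EFinM H_conv muleCA; congr (_ * _)%E.
  rewrite -ge0_integralZl//.
  - by apply/measurable_EFinP/measurable_funM; [exact: measurable_ramp|exact: mtH].
  - by move=> y _; rewrite lee_fin mulr_ge0// ramp_ge0.
  - by rewrite lee_fin.
congr (_ * _)%E; rewrite (@fubini_tonelli _ _ _ _ _ _ _ F)//.
apply: eq_integral => y _.
have mFy : measurable_fun setT (fun t => F (t, y)) by exact: measurable_fun_pair1.
rewrite [LHS](@integral_affine _ 1 y)//.
rewrite mul1e -ge0_integralZl//; last 3 first.
- apply/measurable_EFinP/measurable_funM; last exact: mH.
  by apply: (measurableT_comp mw); exact: measurable_funD.
- by move=> s _; rewrite lee_fin mulr_ge0.
- by rewrite lee_fin ramp_ge0.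
by apply: eq_integral => s _; rewrite /F/= mul1r addrK -EFinM mulrCA.
Qed.

Hypothesis H_neg : forall t, t <= 0 -> H t = 0.
Hypothesis H_loc : forall N, 0 < N -> (\int[mu]_(t in `]0%R, N[) (H t)%:E < +oo)%E.

Definition below (N t : R) : R := \1_(`]-oo, N[%classic) t.

Lemma integral_below N : (\int[mu]_t (below N t * H t)%:E = \int[mu]_(t in `]0%R,
    N[) (H t)%:E)%E.
Proof.
rewrite [RHS]integral_mkcond; apply: eq_integral => t _.
rewrite patchE /below indicE.
have [tN|tN] := boolP (t \in `]0%R, N[%classic).
  by rewrite mem_set ?mul1r//; move: tN; rewrite inE/= !in_itv/= => /andP[].
have [t0|t0] := leP t 0; first by rewrite H_neg ?mulr0.
rewrite memNset ?mul0r// => /= tN'; move: tN; rewrite notin_setE/= in_itv/= t0/=; apply.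
by move: tN'; rewrite in_itv.
Qed.

Lemma measurable_below N : measurable_fun setT (below N).
Proof. exact/measurable_indicP. Qed.

Lemma below_ge0 N t : 0 <= below N t. Proof. by rewrite /below indicE. Qed.

(** Shifting [s] to the right by [y >= 0] can only leave the half-line [t <
N], and the ramp has mass at most [1]. *)
Lemma integral_below_moment N :
  (\int[mu]_t (below N t * (t * H t))%:E <= theta%:E * \int[mu]_t (below N t * H t)%:E)%E.
Proof.
rewrite (integral_weight (measurable_below N) (below_ge0 N)).
apply: lee_wpmul2l; first by rewrite lee_fin ltW.
set I := (X in (_ <= X)%E).
have mb := measurable_below N.
have mI : measurable_fun setT (fun y =>
    (ramp y)%:E * \int[mu]_s (below N (s + y) * H s)%:E)%E.
  apply: emeasurable_funM; first by apply/measurable_EFinP; exact: measurable_ramp.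
  by apply: measurable_integral_shift => // t; exact: below_ge0.
have mr : measurable_fun setT (fun y => (ramp y)%:E * I)%E.
  by apply: emeasurable_funM => //; apply/measurable_EFinP; exact: measurable_ramp.
have I0 : (0 <= I)%E by apply: integral_ge0 => t _; rewrite lee_fin mulr_ge0// below_ge0.
apply: (@le_trans _ _ (\int[mu]_y ((ramp y)%:E * I))%E).
  apply: ge0_le_integral => //.
  - move=> y _; rewrite mule_ge0 ?lee_fin ?ramp_ge0//.
    by apply: integral_ge0 => s _; rewrite lee_fin mulr_ge0// below_ge0.
  - move=> y _; have [y0|y0] := ltP y 0; first by rewrite ramp_neg// !mul0e.
    apply: lee_wpmul2l; first by rewrite lee_fin ramp_ge0.
    apply: ge0_le_integral => //.
    + by move=> s _; rewrite lee_fin mulr_ge0// below_ge0.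
    + apply/measurable_EFinP/measurable_funM => //.
      by apply: (measurableT_comp mb); exact: measurable_funD.
    + by apply/measurable_EFinP/measurable_funM.
    + move=> s _; rewrite lee_fin ler_wpM2r // /below !indicE ler_nat.
      have [|//] := boolP (s + y \in _); rewrite inE/= in_itv/= => syN.
      by rewrite mem_set//= in_itv/=; lra.
rewrite ge0_integralZr//; last 2 first.
- by apply/measurable_EFinP; exact: measurable_ramp.
- by move=> y _; rewrite lee_fin ramp_ge0.
by rewrite -[leRHS]mul1e; apply: lee_wpmul2r => //; exact: integral_ramp_le1.
Qed.

(** On [t >= 2 * theta] one has [H t <= t * H t / (2 * theta)], whose integral
up to [N] is at most half of the integral of [H] by [integral_below_moment];
that half is moved to the left side, where it is finite. *)
Lemma integral_H_below_le N : 0 < N ->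
  (\int[mu]_t (below N t * H t)%:E <=
   2%:E * \int[mu]_t (below (2 * theta) t * H t)%:E)%E.
Proof.
move=> N0; have c0 : 0 < 2 * theta by rewrite mulr_gt0.
have mb M : measurable_fun setT (fun t => below M t * H t).
  by apply: measurable_funM => //; exact: measurable_below.
have mj : measurable_fun setT (fun t => below N t * (t * H t)).
  by apply: measurable_funM; [exact: measurable_below|exact: measurable_funM].
have j0 t : 0 <= below N t * (t * H t).
  rewrite mulr_ge0// ?below_ge0//; have [t0|t0] := leP t 0; first by rewrite H_neg ?mulr0.
  by rewrite mulr_ge0// ltW.
have fin M : 0 < M -> (\int[mu]_t (below M t * H t)%:E)%E \is a fin_num.
  move=> M0; rewrite integral_below ge0_fin_numE ?H_loc//.
  by apply: integral_ge0 => t _; rewrite lee_fin.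
have : (\int[mu]_t (below N t * H t)%:E <=
    \int[mu]_t (below (2 * theta) t * H t)%:E +
    (2 * theta)^-1%:E * (theta%:E * \int[mu]_t (below N t * H t)%:E))%E.
  apply: (@le_trans _ _ (\int[mu]_t ((below (2 * theta) t * H t)%:E +
      (2 * theta)^-1%:E * (below N t * (t * H t))%:E))%E).
    apply: ge0_le_integral => //.
    - by move=> t _; rewrite lee_fin mulr_ge0// below_ge0.
    - by apply/measurable_EFinP; exact: mb.
    - apply: emeasurable_funD; first by apply/measurable_EFinP; exact: mb.
      by apply: emeasurable_funM => //; by apply/measurable_EFinP.
    - move=> t _; rewrite -EFinM -EFinD lee_fin.
      have [t0|t0] := leP t 0; first by rewrite H_neg ?mulr0// add0r mulr0.
      have [tc|tc] := ltP t (2 * theta).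
        rewrite /below [X in _ <= X * _ + _]indicE mem_set/= ?in_itv//= mul1r.
        rewrite -[leLHS]addr0 lerD// ?mulr_ge0// ?invr_ge0 ?(ltW c0) ?(ltW t0) //.
        by rewrite ler_piMl// indicE ler_nat leq_b1.
      rewrite -[leLHS]add0r lerD//; first by rewrite mulr_ge0// below_ge0.
      rewrite mulrCA ler_wpM2l ?below_ge0// mulrA ler_peMl//.
      by rewrite mulrC ler_pdivlMr// mul1r.
  rewrite ge0_integralD//; last 4 first.
  - by move=> t _; rewrite lee_fin mulr_ge0// below_ge0.
  - by apply/measurable_EFinP; exact: mb.
  - by move=> t _; rewrite -EFinM lee_fin mulr_ge0// invr_ge0 ltW.
  - by apply: emeasurable_funM => //; by apply/measurable_EFinP.
  apply: leeD => //; rewrite ge0_integralZl//; last 3 first.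
  - by apply/measurable_EFinP.
  - by move=> t _; rewrite lee_fin.
  - by rewrite lee_fin invr_ge0 ltW.
  apply: lee_wpmul2l; first by rewrite lee_fin invr_ge0 ltW.
  exact: integral_below_moment.
move: (fin N N0) (fin _ c0).
set I := (\int[mu]_t (below N t * H t)%:E)%E; set a := (\int[mu]_t _)%E.
move=> /fineK <- /fineK <-; rewrite -!EFinM -EFinD !lee_fin => h.
have : (2 * theta)^-1 * (theta * fine I) = fine I / 2 by field; exact: lt0r_neq0.
move: h => /[swap] ->; lra.
Qed.

Lemma integral_H_lty : (\int[mu]_t (H t)%:E < +oo)%E.
Proof.
have c0 : 0 < 2 * theta by rewrite mulr_gt0.
(* the shift by one keeps the truncation level positive *)
pose g n t := (below n.+1%:R t * H t)%:E.
have gH t : g n t @[n --> \oo] --> (H t)%:E.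
  apply: cvg_near_cst; near=> n; rewrite /g; congr (_%:E).
  rewrite /below indicE mem_set ?mul1r//= in_itv/=.
  rewrite (@lt_trans _ _ n%:R) ?ltr_nat//.
  by near: n; exact: nbhs_infty_gtr.
have cvgI : (\int[mu]_t g n t @[n --> \oo] --> \int[mu]_t (H t)%:E)%E.
  rewrite (_ : (\int[mu]_t (H t)%:E = \int[mu]_t limn (g^~ t))%E); last first.
    by apply: eq_integral => t _; apply/esym/cvg_lim.
  apply: cvg_monotone_convergence => //.
  - move=> n; apply/measurable_EFinP/measurable_funM => //; exact: measurable_below.
  - by move=> n t _; rewrite lee_fin mulr_ge0// below_ge0.
  - move=> t _ m n mn; rewrite lee_fin ler_wpM2r// /below !indicE ler_nat.
    have [|//] := boolP (t \in `]-oo, m.+1%:R[%classic); rewrite inE/= in_itv/= => tm.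
    by rewrite mem_set//= in_itv/= (lt_le_trans tm)// ler_nat.
rewrite -(cvg_lim _ cvgI)//.
apply: (@le_lt_trans _ _ (2%:E * \int[mu]_t (below (2 * theta) t * H t)%:E)%E).
  apply: lime_le; first exact: cvgP cvgI.
  by apply: nearW => n; exact: integral_H_below_le.
by rewrite lte_mul_pinfty// ?lee_fin// integral_below H_loc.
Unshelve. all: by end_near.
Qed.

Lemma integrable_H : mu.-integrable setT (EFin \o H).
Proof.
apply/integrableP; split; first by apply/measurable_EFinP.
by under eq_integral do rewrite /= ger0_norm//; exact: integral_H_lty.
Qed.

Lemma moment_ge0 t : 0 <= t * H t.
Proof.
by have [t0|t0] := leP t 0; [rewrite H_neg ?mulr0|rewrite mulr_ge0// ltW].
Qed.

Lemma integrable_moment : mu.-integrable setT (fun t => (t * H t)%:E).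
Proof.
apply/integrableP; split; first by apply/measurable_EFinP; exact: measurable_funM.
under eq_integral do rewrite /= ger0_norm ?moment_ge0// -[X in X%:E]mul1r.
rewrite (@integral_weight (fun=> 1))//.
under eq_integral do under eq_integral do rewrite mul1r.
have I0 : (0 <= \int[mu]_s (H s)%:E)%E by apply: integral_ge0 => t _; rewrite lee_fin.
rewrite ge0_integralZr//; last 2 first.
- by apply/measurable_EFinP; exact: measurable_ramp.
- by move=> y _; rewrite lee_fin ramp_ge0.
apply: lte_mul_pinfty; rewrite ?lee_fin ?(ltW theta_gt0)//.
apply: (@le_lt_trans _ _ (1 * \int[mu]_s (H s)%:E)%E);
    last by rewrite mul1e integral_H_lty.
by apply: lee_wpmul2r => //; exact: integral_ramp_le1.
Qed.

Lemma integrable_ramp : mu.-integrable setT (EFin \o ramp).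
Proof.
apply/integrableP; split; first by apply/measurable_EFinP; exact: measurable_ramp.
under eq_integral do rewrite /= ger0_norm ?ramp_ge0//.
by rewrite (le_lt_trans integral_ramp_le1)// ltry.
Qed.

End Integrability.

(** * Derivatives of sine and cosine transforms *)

Section TrigonometricTransforms.
Context {R : realType}.
Local Notation mu := (@lebesgue_measure R).

Definition cos_tr (f : R -> R) (l : R) : R := \int[mu]_t (cos (l * t) * f t).
Definition sin_tr (f : R -> R) (l : R) : R := \int[mu]_t (sin (l * t) * f t).

Lemma measurable_trig (g : R -> R) (l : R) : continuous g ->
  measurable_fun setT (fun t : R => g (l * t)).
Proof.
move=> cg; apply: (measurableT_comp (continuous_measurable_fun cg)).
exact: measurable_funM.
Qed.

Lemma integrable_trig (g f : R -> R) (l : R) : continuous g ->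
    (forall t, `|g t| <= 1) -> mu.-integrable setT (EFin \o f) ->
  mu.-integrable setT (fun t => (g (l * t) * f t)%:E).
Proof.
move=> cg g1 intf; apply: (le_integrable _ _ _ intf) => //.
  apply/measurable_EFinP; apply: measurable_funM; first exact: measurable_trig.
  by apply/measurable_EFinP; case/integrableP: intf.
by move=> t _; rewrite /= lee_fin normrM ler_piMl.
Qed.

(** Differentiation under the integral sign, dominated by [t * f t]. *)
Lemma is_derive_trig_transform (g dg f : R -> R) (l : R) :
    continuous g -> continuous dg ->
    (forall t, `|g t| <= 1) -> (forall t, `|dg t| <= 1) ->
    (forall t : R, is_derive t 1 g (dg t)) ->
    mu.-integrable setT (EFin \o f) ->
    mu.-integrable setT (fun t => (t * f t)%:E) ->
  is_derive l 1 (fun l => \int[mu]_t (g (l * t) * f t))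
                (\int[mu]_t (dg (l * t) * (t * f t))).
Proof.
move=> cg cdg g1 dg1 ddg intf inttf.
have dF (t x : R) : is_derive x 1 (fun x : R => g (x * t) * f t) (dg (x * t) * (t * f t)).
  have dtx : is_derive x (1:R) (t \*: (@id R)) (t *: 1) by exact: is_deriveZ.
  have dgx : is_derive ((t \*: (@id R)) x) (1:R) g (dg (x * t)).
    by rewrite /= [t *: x]mulrC; exact: ddg.
  have := is_deriveZ (f t) (is_derive1_comp dgx dtx).
  rewrite (_ : f t \*: (g \o (t \*: @id R)) = (fun x : R => g (x * t) * f t)); last first.
    by apply/funext => y; rewrite /= [t *: y]mulrC [LHS]mulrC.
  by rewrite (_ : f t *: _ = dg (x * t) * (t * f t))// /GRing.scale /= mulr1; ring.
have hIl : [set` `]l - 1, l + 1[] l by rewrite /= in_itv/=; apply/andP; split; lra.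
have intg x : [set` `](l - 1)%R, (l + 1)%R[] x ->
    mu.-integrable setT (EFin \o (fun t => g (x * t) * f t)).
  by move=> _; exact: integrable_trig.
have G0 t : 0 <= `|t * f t| by [].
have intG : mu.-integrable setT (EFin \o (fun t => `|t * f t|)).
  exact: integrable_norm.
have bnd x t : [set` `](l - 1)%R, (l + 1)%R[] x -> setT t ->
   `|partial1of2 (fun x t => g (x * t) * f t) x t| <= `|t * f t|.
  move=> _ _; rewrite partial1of2E; have dFx := dF t x; rewrite derive_val.
  by rewrite normrM ler_piMl.
have der x t : [set` `](l - 1)%R, (l + 1)%R[] x -> setT t ->
    derivable ((fun x t => g (x * t) * f t) ^~ t) x 1.
  by move=> _ _; have dFx := dF t x; exact: ex_derive.
apply: DeriveDef.
  exact: (@derivable_under_integral _ _ _ mu _ _ measurableT l _ _ hIl intg der _ G0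
      intG bnd).
rewrite -derive1E (@differentiation_under_integral _ _ _ mu _ _ measurableT l _ _ hIl
    intg der _ G0 intG bnd).
apply: eq_Rintegral => t _; by rewrite partial1of2E; have dFl := dF t l;
    rewrite derive_val.
Qed.

End TrigonometricTransforms.

(** * Transforms of the ramp *)

Section RampTransforms.
Context {R : realType}.
Local Notation mu := (@lebesgue_measure R).

Lemma Rintegral_is_derive (f F : R -> R) (a b : R) : a < b -> continuous f ->
    (forall x : R, is_derive x 1 F (f x)) ->
  \int[mu]_(x in `[a, b]) f x = F b - F a.
Proof.
move=> ab cf dF; rewrite /Rintegral (@continuous_FTC2 _ f F)//.
- exact: continuous_subspaceT.
- have cF : continuous F.
    by move=> x; apply/differentiable_continuous/derivable1_diffP; have dFx := dF x;
        exact: ex_derive.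
  split.
  + by move=> x _; have dFx := dF x; exact: ex_derive.
  + exact/cvg_at_right_filter/cF.
  + exact/cvg_at_left_filter/cF.
- by move=> x _; have dFx := dF x; rewrite derive1E derive_val.
Qed.

Lemma trig_rampE (g : R -> R) (m : R) :
  \int[mu]_t (g (m * t) * ramp t) = \int[mu]_(t in `[0%R, 1%R]) ((1 - t) * g (m * t)).
Proof.
rewrite /Rintegral; congr fine; rewrite -integral_rampE.
by apply: eq_integral => t _; rewrite mulrC.
Qed.

Lemma is_derive_scaled (g dg : R -> R) (m x : R) :
  (forall t : R, is_derive t 1 g (dg t)) ->
  is_derive x (1 : R) (g \o (m \*: (@id R))) (dg (m * x) * m).
Proof.
move=> ddg.
have dmx : is_derive x (1:R) (m \*: (@id R)) (m *: 1) by exact: is_deriveZ.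
have dgx : is_derive ((m \*: (@id R)) x) (1:R) g (dg (m * x)) by exact: ddg.
by have := is_derive1_comp dgx dmx; rewrite [m *: 1]mulr1.
Qed.

Lemma continuous_scaled_ramp (g : R -> R) (m : R) : continuous g ->
  continuous (fun t : R => (1 - t) * g (m * t)).
Proof.
move=> cg t; apply: cvgM.
  by apply: cvgB; [exact: cvg_cst|exact: cvg_id].
by apply: continuous_comp; [apply: cvgM; [exact: cvg_cst|exact: cvg_id]|exact: cg].
Qed.

Lemma cos_tr_ramp (m : R) : m != 0 -> cos_tr ramp m = (1 - cos m) / m ^+ 2.
Proof.
move=> m0; rewrite /cos_tr trig_rampE.
pose F : R -> R := (cst 1 - id) * (m^-1 \*: (sin \o (m \*: (@id R))))
   - (m ^- 2 \*: (cos \o (m \*: (@id R)))).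
have dF (x : R) : is_derive x 1 F ((1 - x) * cos (m * x)).
  have ds := is_derive_scaled m x (@is_derive_sin R).
  have dc := is_derive_scaled m x (@is_derive_cos R).
  apply: is_derive_eq; rewrite /GRing.scale/=.
  change ((1 - x) * (m^-1 * (cos (m * x) * m)) + m^-1 * sin (m * x) * (0 - 1)
    - m ^- 2 * (- sin (m * x) * m) = (1 - x) * cos (m * x)).
  field; exact: m0.
rewrite (Rintegral_is_derive ltr01 (continuous_scaled_ramp (@continuous_cos R)) dF).
change ((1 - 1) * (m^-1 * sin (m * 1)) - m ^- 2 * cos (m * 1)
  - ((1 - 0) * (m^-1 * sin (m * 0)) - m ^- 2 * cos (m * 0)) = (1 - cos m) / m ^+ 2).
by rewrite mulr1 mulr0 sin0 cos0; field; exact: m0.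
Qed.

Lemma sin_tr_ramp (m : R) : m != 0 -> sin_tr ramp m = (m - sin m) / m ^+ 2.
Proof.
move=> m0; rewrite /sin_tr trig_rampE.
pose F : R -> R := (id - cst 1) * (m^-1 \*: (cos \o (m \*: (@id R))))
   - (m ^- 2 \*: (sin \o (m \*: (@id R)))).
have dF (x : R) : is_derive x 1 F ((1 - x) * sin (m * x)).
  have ds := is_derive_scaled m x (@is_derive_sin R).
  have dc := is_derive_scaled m x (@is_derive_cos R).
  apply: is_derive_eq; rewrite /GRing.scale/=.
  change ((x - 1) * (m^-1 * (- sin (m * x) * m)) + m^-1 * cos (m * x) * (1 - 0)
    - m ^- 2 * (cos (m * x) * m) = (1 - x) * sin (m * x)).
  field; exact: m0.
rewrite (Rintegral_is_derive ltr01 (continuous_scaled_ramp (@continuous_sin R)) dF).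
change ((1 - 1) * (m^-1 * cos (m * 1)) - m ^- 2 * sin (m * 1)
  - ((0 - 1) * (m^-1 * cos (m * 0)) - m ^- 2 * sin (m * 0)) = (m - sin m) / m ^+ 2).
by rewrite mulr1 mulr0 sin0 cos0; field; exact: m0.
Qed.

End RampTransforms.

(** * Transforms of the convolution equation *)

Section TrigonometricConvolution.
Context {R : realType}.
Local Notation mu := (@lebesgue_measure R).

Lemma EFin_Rintegral (f : R -> R) : mu.-integrable setT (EFin \o f) ->
  (\int[mu]_t (f t)%:E = (\int[mu]_t f t)%R%:E)%E.
Proof. by move=> intf; rewrite /Rintegral fineK// integrable_fin_num. Qed.

Lemma integrable_lin (f g : R -> R) (a : R) :
    mu.-integrable setT (EFin \o f) -> mu.-integrable setT (EFin \o g) ->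
  mu.-integrable setT (fun t => (f t + a * g t)%:E).
Proof.
by move=> intf intg; exact: (integrableD measurableT intf (integrableZl measurableT a
    intg)).
Qed.

Lemma Rintegral_lin (f g : R -> R) (a : R) :
    mu.-integrable setT (EFin \o f) -> mu.-integrable setT (EFin \o g) ->
  \int[mu]_t (f t + a * g t) = \int[mu]_t f t + a * \int[mu]_t g t.
Proof.
move=> intf intg; rewrite RintegralD//; last exact: (integrableZl measurableT a intg).
by rewrite RintegralZl.
Qed.

Variables (theta : R) (H : R -> R).
Hypotheses (theta_gt0 : 0 < theta) (mH : measurable_fun setT H)
  (H_ge0 : forall t, 0 <= H t).
Hypothesis H_conv : forall t,
  (t * H t)%:E = (theta%:E * \int[mu]_y (ramp y * H (t - y))%:E)%E.
Hypothesis intH : mu.-integrable setT (EFin \o H).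
Hypothesis inttH : mu.-integrable setT (fun t => (t * H t)%:E).

(** The transform of the convolution of [ramp] and [H] splits as in the formula
[gD]. Apply [integral_weight] to [1] and to [1 + g], which are nonnegative,
and subtract. *)
Lemma trig_convolution (g a1 b1 a2 b2 : R -> R) (e l : R) :
    continuous g -> continuous a1 -> continuous b1 -> continuous a2 -> continuous b2 ->
    (forall t, `|g t| <= 1) -> (forall t, `|a1 t| <= 1) -> (forall t, `|b1 t| <= 1) ->
    (forall t, `|a2 t| <= 1) -> (forall t, `|b2 t| <= 1) ->
    (forall u v, g (u + v) = a1 v * b1 u + e * (a2 v * b2 u)) ->
  \int[mu]_t (g (l * t) * (t * H t)) =
  theta * ((\int[mu]_y (a1 (l * y) * ramp y)) * (\int[mu]_t (b1 (l * t) * H t)) +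
      e * ((\int[mu]_y (a2 (l * y) * ramp y)) * (\int[mu]_t (b2 (l * t) * H t)))).
Proof.
move=> cg ca1 cb1 ca2 cb2 g1 a11 b11 a21 b21 gD.
set A1 := \int[mu]_y (a1 _ * _); set B1 := \int[mu]_t (b1 _ * _).
set A2 := \int[mu]_y (a2 _ * _); set B2 := \int[mu]_t (b2 _ * _).
set X := \int[mu]_t _.
pose I := \int[mu]_t H t; pose M := \int[mu]_t (t * H t); pose Rp := \int[mu]_y @ramp R y.
have iR := @integrable_ramp R.
have ia1 : mu.-integrable setT (EFin \o (fun y =>
    a1 (l * y) * ramp y)) by exact: integrable_trig.
have ia2 : mu.-integrable setT (EFin \o (fun y =>
    a2 (l * y) * ramp y)) by exact: integrable_trig.
have ib1 : mu.-integrable setT (EFin \o (fun y =>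
    b1 (l * y) * H y)) by exact: integrable_trig.
have ib2 : mu.-integrable setT (EFin \o (fun y =>
    b2 (l * y) * H y)) by exact: integrable_trig.
have ig : mu.-integrable setT (EFin \o (fun y => g (l * y) * (y * H y))).
  by apply: (@integrable_trig _ g (fun y => y * H y)).
(* the weight 1 *)
have E1 : M = theta * (Rp * I).
  have := @integral_weight _ _ _ theta_gt0 mH H_ge0 H_conv (fun=> 1).
  have -> : (\int[mu]_t (1 * (t * H t))%:E = M%:E)%E.
    by rewrite -EFin_Rintegral//; apply: eq_integral => t _; rewrite mul1r.
  have -> : (\int[mu]_y ((ramp y)%:E * \int[mu]_s (1 * H s)%:E) = (Rp * I)%:E)%E.
    have iRI : mu.-integrable setT (EFin \o (fun y => ramp y * I)).
      exact: (integrableZr measurableT I iR).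
    rewrite -[Rp * I]RintegralZr// -(EFin_Rintegral iRI).
    apply: eq_integral => y _; rewrite [RHS]EFinM -(EFin_Rintegral intH); congr (_ * _)%E.
    by apply: eq_integral => s _; rewrite mul1r.
  by rewrite -EFinM => h; have [] := h (measurable_cst _) (fun=> ler01).
have inner y : (\int[mu]_s ((1 + g (l * (s + y))) * H s)%:E =
    (I + (a1 (l * y) * B1 + e * (a2 (l * y) * B2)))%:E)%E.
  rewrite (_ : I + _ = I + a1 (l * y) * B1 + (e * a2 (l * y)) * B2); last by ring.
  rewrite -!Rintegral_lin//; last exact: integrable_lin.
  rewrite -EFin_Rintegral; last by apply: integrable_lin => //; exact: integrable_lin.
  by apply: eq_integral => s _; rewrite mulrDr gD; congr (_%:E); ring.
(* the weight 1 + g, nonnegative since |g| <= 1 *)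
have E2 : M + X = theta * (Rp * I + (A1 * B1 + e * (A2 * B2))).
  have := @integral_weight _ _ _ theta_gt0 mH H_ge0 H_conv (fun t => 1 + g (l * t)).
  have -> : (\int[mu]_t ((1 + g (l * t)) * (t * H t))%:E = (M + X)%:E)%E.
    rewrite -[X]mul1r -Rintegral_lin// -EFin_Rintegral; last exact: integrable_lin.
    by apply: eq_integral => t _; congr (_%:E); ring.
  under eq_integral do rewrite inner.
  have -> : (\int[mu]_y ((ramp y)%:E * (I + (a1 (l * y) * B1 + e * (a2 (l * y) *
      B2)))%:E) =
      (Rp * I + (A1 * B1 + e * (A2 * B2)))%:E)%E.
    rewrite (_ : Rp * I + _ = (I * Rp + B1 * A1) + (e * B2) * A2); last by ring.
    have iRI : mu.-integrable setT (EFin \o (fun y => I * ramp y)).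
      exact: (integrableZl measurableT I iR).
    rewrite -[I * Rp]RintegralZl// -!Rintegral_lin//; last exact: integrable_lin.
    rewrite -EFin_Rintegral; last by apply: integrable_lin => //; exact: integrable_lin.
    by apply: eq_integral => y _; rewrite -EFinM; congr (_%:E); ring.
  have mw : measurable_fun setT (fun t : R => 1 + g (l * t)).
    by apply: measurable_funD => //; exact: measurable_trig.
  have w0 t : 0 <= 1 + g (l * t).
    by have := g1 (l * t); rewrite ler_norml => /andP[]; lra.
  by rewrite -EFinM => h; exact: (EFin_inj (h mw w0)).
by apply: (addrI M); rewrite E2 E1; ring.
Qed.

End TrigonometricConvolution.

(** * The differential system of the transform and its solution *)

Section FourierODE.
Context {R : realType}.
Local Notation mu := (@lebesgue_measure R).

Lemma continuous_neg_sin : continuous (fun t : R => - sin t).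
Proof. by move=> t; apply: cvgN; exact: continuous_sin. Qed.

Lemma Rintegral_opp (f : R -> R) : mu.-integrable setT (EFin \o f) ->
  \int[mu]_t (- f t) = - \int[mu]_t f t.
Proof.
move=> intf; rewrite -[RHS]mulN1r -RintegralZl//.
by apply: eq_Rintegral => t _; rewrite mulN1r.
Qed.

Lemma is_derive_cos_tr (f : R -> R) (l : R) :
    mu.-integrable setT (EFin \o f) -> mu.-integrable setT (fun t => (t * f t)%:E) ->
  is_derive l 1 (cos_tr f) (- sin_tr (fun t => t * f t) l).
Proof.
move=> intf inttf.
have <- : \int[mu]_t (- sin (l * t) * (t * f t)) = - sin_tr (fun t => t * f t) l.
  rewrite /sin_tr -Rintegral_opp; last first.
    by apply: (@integrable_trig _ sin (fun t => t * f t)) => //;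
        [exact: continuous_sin|exact: sin_max].
  by apply: eq_Rintegral => t _; rewrite mulNr.
apply: (@is_derive_trig_transform _ cos (fun t => - sin t)) => //.
- exact: continuous_cos.
- exact: continuous_neg_sin.
- exact: cos_max.
- by move=> t; rewrite normrN; exact: sin_max.
Qed.

Lemma is_derive_sin_tr (f : R -> R) (l : R) :
    mu.-integrable setT (EFin \o f) -> mu.-integrable setT (fun t => (t * f t)%:E) ->
  is_derive l 1 (sin_tr f) (cos_tr (fun t => t * f t) l).
Proof.
move=> intf inttf; apply: (@is_derive_trig_transform _ sin cos) => //.
- exact: continuous_sin.
- exact: continuous_cos.
- exact: sin_max.
- exact: cos_max.
Qed.

Lemma is_derive_continuous (f df : R -> R) :
  (forall x : R, is_derive x 1 f (df x)) -> continuous f.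
Proof.
move=> d x; apply/differentiable_continuous/derivable1_diffP.
by have dx := d x; exact: ex_derive.
Qed.

Lemma integrable_ramp_moment : mu.-integrable setT (fun t : R => (t * ramp t)%:E).
Proof.
apply: (le_integrable _ _ _ (@integrable_ramp R)) => //.
  by apply/measurable_EFinP; apply: measurable_funM => //; exact: measurable_ramp.
move=> t _; rewrite /= lee_fin normrM /ramp indicE.
have [|_] := boolP (t \in _); last by rewrite mul0r normr0 mulr0.
by rewrite inE/= in_itv/= => /andP[t0 t1]; rewrite ler_piMl// ger0_norm.
Qed.

Lemma continuous_cos_tr_ramp : continuous (cos_tr (@ramp R)).
Proof.
apply: is_derive_continuous => x; apply: is_derive_cos_tr.
  exact: integrable_ramp.
exact: integrable_ramp_moment.
Qed.

Lemma continuous_sin_tr_ramp : continuous (sin_tr (@ramp R)).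
Proof.
apply: is_derive_continuous => x; apply: is_derive_sin_tr.
  exact: integrable_ramp.
exact: integrable_ramp_moment.
Qed.

Lemma continuous_integrable_itv (f : R -> R) (a b : R) : continuous f ->
  mu.-integrable `[a, b] (EFin \o f).
Proof.
move=> cf; apply: continuous_compact_integrable; first exact: segment_compact.
exact: continuous_subspaceT.
Qed.

Lemma is_derive_primitive (f : R -> R) (a b x : R) : continuous f -> a < x < b ->
  is_derive x 1 (fun y : R => \int[mu]_(t in `[a, y]) f t) (f x).
Proof.
move=> cf /andP[ax xb].
have [d1 d2] := continuous_FTC1_closed xb (continuous_integrable_itv a b cf) ax (cf x).
by apply: DeriveDef; [exact: d1|rewrite -derive1E d2].
Qed.

Lemma is_derive0_cst (f : R -> R) (a b : R) :
    (forall x : R, a < x < b -> is_derive x 1 f 0) ->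
  forall x y, a < x < b -> a < y < b -> f x = f y.
Proof.
move=> df; suff suf x y : a < x -> x < y -> y < b -> f x = f y.
  move=> x y /andP[ax xb] /andP[ay yb]; have [xy|yx|->//] := ltgtP x y.
    exact: suf.
  by apply/esym; exact: suf.
move=> ax xy yb.
have [||c _ h] := @MVT _ f (fun=> 0) x y xy.
- by move=> z; rewrite in_itv/= => /andP[xz zy]; apply: df;
    rewrite (lt_trans ax xz) (lt_trans zy yb).
- apply: derivable_within_continuous => z; rewrite in_itv/= => /andP[xz zy].
  have dfz : is_derive z 1 f 0 by apply: df;
      rewrite (lt_le_trans ax xz) (le_lt_trans zy yb).
  exact: ex_derive.
by apply/esym/eqP; rewrite -subr_eq0 h mul0r.
Qed.

Variables (theta : R) (H : R -> R).
Hypotheses (theta_gt0 : 0 < theta) (mH : measurable_fun setT H)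
  (H_ge0 : forall t, 0 <= H t).
Hypothesis H_conv : forall t,
  (t * H t)%:E = (theta%:E * \int[mu]_y (ramp y * H (t - y))%:E)%E.
Hypothesis intH : mu.-integrable setT (EFin \o H).
Hypothesis inttH : mu.-integrable setT (fun t => (t * H t)%:E).

Local Notation p := (cos_tr (@ramp R)).
Local Notation q := (sin_tr (@ramp R)).
Local Notation A := (cos_tr H).
Local Notation S := (sin_tr H).

Lemma cos_tr_moment l : cos_tr (fun t => t * H t) l = theta * (p l * A l - q l * S l).
Proof.
rewrite /cos_tr (@trig_convolution _ _ _ theta_gt0 mH H_ge0 H_conv intH inttH cos cos
    cos sin sin (-1) l).
  by rewrite mulN1r.
- exact: continuous_cos.
- exact: continuous_cos.
- exact: continuous_cos.
- exact: continuous_sin.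
- exact: continuous_sin.
- exact: cos_max.
- exact: cos_max.
- exact: cos_max.
- exact: sin_max.
- exact: sin_max.
- by move=> u v; rewrite cosD; ring.
Qed.

Lemma sin_tr_moment l : sin_tr (fun t => t * H t) l = theta * (p l * S l + q l * A l).
Proof.
rewrite /sin_tr (@trig_convolution _ _ _ theta_gt0 mH H_ge0 H_conv intH inttH sin cos
    sin sin cos 1 l).
  by rewrite mul1r.
- exact: continuous_sin.
- exact: continuous_cos.
- exact: continuous_sin.
- exact: continuous_sin.
- exact: continuous_cos.
- exact: sin_max.
- exact: cos_max.
- exact: sin_max.
- exact: sin_max.
- exact: cos_max.
- by move=> u v; rewrite sinD; ring.
Qed.

(** The transform [A - i S] of [H] satisfies [F' = -i theta (p - i q) F].
Multiplying by the inverse of the expected solution gives a function whose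
real and imaginary parts [F1] and [F2] have derivative zero; its value at [0]
is the transform at [0] because [P] and [Q] vanish there. *)
Lemma fourier_solution (P Q : R -> R) (a b : R) :
    P 0 = 0 -> Q 0 = 0 -> a < 0 < b ->
    (forall x : R, a < x < b -> is_derive x 1 P (p x)) ->
    (forall x : R, a < x < b -> is_derive x 1 Q (q x)) ->
  forall l, a < l < b ->
    A l = expR (- (theta * Q l)) * (cos (theta * P l) * A 0 - sin (theta * P l) * S 0) /\
    S l = expR (- (theta * Q l)) * (sin (theta * P l) * A 0 + cos (theta * P l) * S 0).
Proof.
move=> P0 Q0 ab dP dQ l lab.
pose E := expR \o (theta \*: Q); pose c := cos \o (theta \*: P);
    pose s := sin \o (theta \*: P).
pose F1 := E * (c * A + s * S).
pose F2 := E * (s * A - c * S).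
have dA (x : R) : is_derive x 1 A (- (theta * (p x * S x + q x * A x))).
  by rewrite -sin_tr_moment; exact: is_derive_cos_tr.
have dS (x : R) : is_derive x 1 S (theta * (p x * A x - q x * S x)).
  by rewrite -cos_tr_moment; exact: is_derive_sin_tr.
have dE (x : R) : a < x < b -> is_derive x 1 E (expR (theta * Q x) * (theta * q x)).
  move=> /dQ dQx; have dtQ : is_derive x 1 (theta \*: Q) (theta * q x) by exact:
      is_deriveZ.
  have dex : is_derive ((theta \*: Q) x) 1 (@expR R) (expR (theta * Q x)) by exact:
      is_derive_expR.
  exact: is_derive1_comp dex dtQ.
have dc (x : R) : a < x < b -> is_derive x 1 c (- sin (theta * P x) * (theta * p x)).
  move=> /dP dPx; have dtP : is_derive x 1 (theta \*: P) (theta * p x) by exact: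
      is_deriveZ.
  have dex : is_derive ((theta \*: P) x) 1 (@cos R) (- sin (theta * P x)) by exact:
      is_derive_cos.
  exact: is_derive1_comp dex dtP.
have ds (x : R) : a < x < b -> is_derive x 1 s (cos (theta * P x) * (theta * p x)).
  move=> /dP dPx; have dtP : is_derive x 1 (theta \*: P) (theta * p x) by exact:
      is_deriveZ.
  have dex : is_derive ((theta \*: P) x) 1 (@sin R) (cos (theta * P x)) by exact:
      is_derive_sin.
  exact: is_derive1_comp dex dtP.
have dF1 (x : R) : a < x < b -> is_derive x 1 F1 0.
  move=> xab; have dEx := dE x xab; have dcx := dc x xab; have dsx := ds x xab.
  have dAx := dA x; have dSx := dS x.
  have := is_deriveM dEx (is_deriveD (is_deriveM dcx dAx) (is_deriveM dsx dSx)).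
  set D := (X in is_derive _ _ _ X -> _); suff -> : D = 0 by [].
  rewrite /D; change (expR (theta * Q x) *
    ((cos (theta * P x) * - (theta * (p x * S x + q x * A x)) +
      A x * (- sin (theta * P x) * (theta * p x))) +
     (sin (theta * P x) * (theta * (p x * A x - q x * S x)) +
      S x * (cos (theta * P x) * (theta * p x)))) +
    (cos (theta * P x) * A x + sin (theta * P x) * S x) *
      (expR (theta * Q x) * (theta * q x)) = 0).
  ring.
have dF2 (x : R) : a < x < b -> is_derive x 1 F2 0.
  move=> xab; have dEx := dE x xab; have dcx := dc x xab; have dsx := ds x xab.
  have dAx := dA x; have dSx := dS x.
  have := is_deriveM dEx (is_deriveB (is_deriveM dsx dAx) (is_deriveM dcx dSx)).
  set D := (X in is_derive _ _ _ X -> _); suff -> : D = 0 by [].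
  rewrite /D; change (expR (theta * Q x) *
    ((sin (theta * P x) * - (theta * (p x * S x + q x * A x)) +
      A x * (cos (theta * P x) * (theta * p x))) -
     (cos (theta * P x) * (theta * (p x * A x - q x * S x)) +
      S x * (- sin (theta * P x) * (theta * p x)))) +
    (sin (theta * P x) * A x - cos (theta * P x) * S x) *
      (expR (theta * Q x) * (theta * q x)) = 0).
  ring.
have F1l : expR (theta * Q l) * (cos (theta * P l) * A l + sin (theta * P l) * S l) = A 0.
  have : F1 l = F1 0 by exact: (is_derive0_cst dF1).
  rewrite -[F1 l]/(expR (theta * Q l) * (cos (theta * P l) * A l + sin (theta * P l)
      * S l)).
  rewrite -[F1 0]/(expR (theta * Q 0) * (cos (theta * P 0) * A 0 + sin (theta * P 0)
      * S 0)).
  by move=> ->; rewrite P0 Q0 !mulr0 expR0 cos0 sin0; ring.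
have F2l : expR (theta * Q l) * (sin (theta * P l) * A l - cos (theta * P l) * S l) =
    - S 0.
  have : F2 l = F2 0 by exact: (is_derive0_cst dF2).
  rewrite -[F2 l]/(expR (theta * Q l) * (sin (theta * P l) * A l - cos (theta * P l)
      * S l)).
  rewrite -[F2 0]/(expR (theta * Q 0) * (sin (theta * P 0) * A 0 - cos (theta * P 0)
      * S 0)).
  by move=> ->; rewrite P0 Q0 !mulr0 expR0 cos0 sin0; ring.
have EE : expR (- (theta * Q l)) * expR (theta * Q l) = 1 by rewrite -expRD addNr expR0.
have cs := cos2Dsin2 (theta * P l).
have -> : S 0 = - (expR (theta * Q l) * (sin (theta * P l) * A l - cos (theta * P l)
    * S l)).
  by rewrite F2l opprK.
rewrite -F1l; split.
  rewrite -[LHS]mul1r -[in LHS]EE -[X in _ * X = _]mul1r -[in X in _ * X = _]cs; ring.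
rewrite -[LHS]mul1r -[in LHS]EE -[X in _ * X = _]mul1r -[in X in _ * X = _]cs; ring.
Qed.

End FourierODE.

(** * Complex form *)

Section ComplexForm.
Context {R : realType}.
Local Notation mu := (@lebesgue_measure R).

Lemma mulNi_real (x : R) : - 'i%C * x%:C%C = Complex 0 (- x).
Proof. by apply/eqP; rewrite eq_complex /=; apply/andP; split; apply/eqP; ring. Qed.

Lemma expC_mulNi (x : R) : expC (- 'i%C * x%:C%C) = Complex (cos x) (- sin x).
Proof. by rewrite mulNi_real /expC /= expR0 cosN sinN !mul1r. Qed.

Lemma fourierE (H : R -> R) (l : R) : mu.-integrable setT (EFin \o H) ->
  fourier H l = Complex (cos_tr H l) (- sin_tr H l).
Proof.
move=> intH; rewrite /fourier /Cintegral; congr Complex.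
  by apply: eq_Rintegral => t _; rewrite expC_mulNi /= mulr0 subr0.
rewrite /sin_tr -Rintegral_opp; last first.
  by apply: integrable_trig => //; [exact: continuous_sin|exact: sin_max].
by apply: eq_Rintegral => t _; rewrite expC_mulNi /= mulr0 add0r mulNr.
Qed.

(** At [m = 0] the quotient is [0 / 0 = 0], whereas the transform of the ramp
is its mass there; the single point does not affect integrals. *)
Lemma levy_exponentE (m : R) :
  (1 - expC (- 'i%C * m%:C%C) - 'i%C * m%:C%C) / m%:C%C ^+ 2 =
  if m == 0 then 0 else Complex (cos_tr (@ramp R) m) (- sin_tr (@ramp R) m).
Proof.
case: eqVneq => [->|m0]; first by rewrite expr0n /= invr0 mulr0.
rewrite expC_mulNi cos_tr_ramp// sin_tr_ramp// -rmorphXn -fmorphV.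
by apply/eqP; rewrite eq_complex /=; apply/andP; split; apply/eqP; field.
Qed.

Lemma Rintegral_except0 (f g : R -> R) (a b : R) : continuous f ->
    (forall m, g m = if m == 0 then 0 else f m) ->
  \int[mu]_(m in `[a, b]) g m = \int[mu]_(m in `[a, b]) f m.
Proof.
move=> cf gE; have mf := continuous_measurable_fun cf.
have mg : measurable_fun setT g.
  rewrite (_ : g = fun m => \1_(~` [set 0]) m * f m).
    apply: measurable_funM => //; apply/measurable_indicP.
    by apply: measurableC.
  apply/funext => m; rewrite gE indicE; case: eqVneq => [->|m0].
    by rewrite memNset ?mul0r//= => /(_ erefl).
  by rewrite mem_set ?mul1r//=; exact/eqP.
rewrite /Rintegral; congr fine; apply: ae_eq_integral => //.
- by apply/measurable_EFinP; exact: measurable_funTS.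
- by apply/measurable_EFinP; exact: measurable_funTS.
exists [set 0]; split => //; first exact: lebesgue_measure_set1.
move=> m /= /not_implyP[_ h]; apply/eqP; apply: contra_notT h => m0.
by rewrite gE (negbTE m0).
Qed.

Lemma Rintegral_itvBB (f : R -> R) (c a b : R) : continuous f -> c <= a -> a <= b ->
  \int[mu]_(m in `[a, b]) f m =
  \int[mu]_(m in `[c, b]) f m - \int[mu]_(m in `[c, a]) f m.
Proof.
move=> cf ca ab.
rewrite Rintegral_itvB ?bnd_simp//; last exact: continuous_integrable_itv.
rewrite Rintegral_itv_obnd_cbnd//.
apply: integrableS (continuous_integrable_itv a b cf) => //.
exact: subset_itv_oc_cc.
Qed.

(** With a base point [c] to the left of both [0] and [l], one formula covers
both orientations and the primitive is differentiable at [0] and [l]. *)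
Lemma Cintegral_oriented_levy (l c : R) : c <= 0 -> c <= l ->
  Cintegral_oriented 0 l
    (fun m => (1 - expC (- 'i%C * m%:C%C) - 'i%C * m%:C%C) / m%:C%C ^+ 2) =
  Complex (\int[mu]_(m in `[c, l]) cos_tr (@ramp R) m - \int[mu]_(m in `[c,
      0]) cos_tr (@ramp R) m)
    (- (\int[mu]_(m in `[c, l]) sin_tr (@ramp R) m - \int[mu]_(m in `[c,
        0]) sin_tr (@ramp R) m)).
Proof.
move=> c0 cl.
have cp := @continuous_cos_tr_ramp R; have cq := @continuous_sin_tr_ramp R.
have cNq : continuous (fun m => - sin_tr (@ramp R) m) by move=> m; apply: cvgN; exact: cq.
have CE a b : Cintegral `[a,
    b] (fun m => (1 - expC (- 'i%C * m%:C%C) - 'i%C * m%:C%C) / m%:C%C ^+ 2) =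
    Complex (\int[mu]_(m in `[a, b]) cos_tr (@ramp R) m) (- \int[mu]_(m in `[a,
        b]) sin_tr (@ramp R) m).
  rewrite /Cintegral; congr Complex.
    by apply: Rintegral_except0 => // m; rewrite levy_exponentE; case: eqP.
  rewrite (@Rintegral_except0 (fun m => - sin_tr (@ramp R) m))//; last first.
    by move=> m; rewrite levy_exponentE; case: eqP.
  rewrite -[RHS]mulN1r -RintegralZl//; last exact: continuous_integrable_itv.
  by apply: eq_Rintegral => m _; rewrite mulN1r.
rewrite /Cintegral_oriented; case: ifPn => [l0|]; rewrite CE.
  by rewrite !(Rintegral_itvBB (c := c) (a := 0)).
rewrite -ltNge => /ltW l0; rewrite !(Rintegral_itvBB (c := c) (a := l))//.
by apply/eqP; rewrite eq_complex /=; apply/andP; split; apply/eqP; ring.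
Qed.

End ComplexForm.

(** * The proposition *)

Section GemGapDensity.
Context {R : realType}.
Local Notation mu := (@lebesgue_measure R).
Context d (T : measurableType d) (P : probability T R)
  d' (T' : measurableType d') (Q : probability T' R).
Variables (theta : R) (chi : nat -> {RV P >-> R}) (V : nat -> {RV Q >-> R}).
Hypotheses (theta_gt0 : 0 < theta)
  (VI : mutually_independent V)
  (Vf : forall i, has_density (V i) `]0, 1[ (fun t => theta * (1 - t) `^ (theta - 1)))
  (chiI : mutually_independent chi) (chi01 : forall m, uniform01 (chi m)).

Local Notation k := (fun t => fine (gem_gap (seq_law V) (seq_law chi) t)).

Lemma gem_gap_fin_num t : gem_gap (seq_law V) (seq_law chi) t \is a fin_num.
Proof.
rewrite ge0_fin_numE; last exact: gem_gap_ge0.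
by rewrite (le_lt_trans (gem_gap_le1 _ _ _))// ltry.
Qed.

Lemma gem_density_ge0 (t : R) : 0 <= theta * (1 - t) `^ (theta - 1).
Proof. by rewrite mulr_ge0// ?powR_ge0// ltW. Qed.

Lemma measurable_gem_density :
  measurable_fun setT (fun t : R => theta * (1 - t) `^ (theta - 1)).
Proof.
apply: measurable_funM => //.
by apply: (measurableT_comp (measurable_powR _)); exact: measurable_funB.
Qed.

Lemma measurable_tail (nu0 : probability R R) (t : R) :
  measurable_fun setT (fun a => nu0 `[(t * a)%R, +oo[%classic).
Proof.
pose A := [set ac : R * R | t * ac.1 <= ac.2].
have mA : measurable A.
  have m1 : measurable_fun setT (fun ac : R * R => t * ac.1).
    by apply: measurable_funM => //; exact: measurable_fst.
  have m2 : measurable_fun setT (fun ac : R * R => ac.2) by exact: measurable_snd.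
  by have := measurable_fun_ler m1 m2 measurableT (Logic.I : measurable [set true]);
      rewrite setTI.
rewrite (_ : (fun a => _) = nu0 \o xsection A); first exact: measurable_fun_xsection.
apply/funext => a; congr (nu0 _); apply/seteqP; split => c;
    rewrite /xsection/= inE/= in_itv/= ?andbT//.
Qed.

Lemma gem_gap_density_rec t : 0 < t -> (k t)%:E =
  (\int[mu]_(a in `]0%R, 1%R[)
     (theta * (1 - a) `^ (theta - 1) * (Num.max 0 (1 - t * a) * k (t * (1 - a))))%:E)%E.
Proof.
move=> t0; rewrite fineK ?gem_gap_fin_num//.
rewrite (gem_gap_rec _ (iid_seq_law VI Vf) (iid_seq_law chiI chi01)).
rewrite (integral_has_density _ _ _ (Vf 0%N))//.
- apply: eq_integral => a; rewrite inE/= in_itv/= => /andP[a0 a1].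
  rewrite (uniform01_tail (chi01 0%N)); last by rewrite mulr_ge0// ltW.
  by rewrite -{1}(fineK (gem_gap_fin_num _)) -!EFinM.
- by apply: measurable_funTS; exact: measurable_gem_density.
- by move=> a _; exact: gem_density_ge0.
- apply: emeasurable_funM.
    exact: measurable_tail.
  apply: (measurableT_comp (measurable_gem_gap _ _)).
  by apply: measurable_funM => //; exact: measurable_funB.
- by move=> a; rewrite mule_ge0// gem_gap_ge0.
Qed.

Lemma gem_density_integral :
  (\int[mu]_(a in `]0%R, 1%R[) (theta * (1 - a) `^ (theta - 1))%:E < +oo)%E.
Proof.
have := Vf 0%N measurableT; rewrite setTI => <-.
by rewrite (le_lt_trans (probability_le1 _ _))// ltry.
Qed.

End GemGapDensity.

Theorem proposition5p9 (R : realType) (theta : R) (theta_gt0 : 0 < theta)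
    (d : measure_display) (T : measurableType d) (P : probability T R)
    (x chi : nat -> {RV P >-> R})
    (x_PD : poisson_dirichlet theta x)
    (chi_uniform : forall m, uniform01 (chi m))
    (chi_indep : mutually_independent chi)
    (x_chi_indep : independent_seqs x chi) :
  let H := H_fun theta (gap_prob x chi) in
  [/\ lebesgue_measure.-integrable [set: R] (EFin \o H),
      forall t : R,
        (t * H t)%:E =
        (theta%:E * \int[lebesgue_measure]_(y in `[0%R, 1%R])
                      ((1 - y) * H (t - y))%:E)%E
    & forall l : R,
        fourier H l =
        fourier H 0 *
        expC (- 'i%C * theta%:C%C *
              Cintegral_oriented 0 l
                (fun mu => (1 - expC (- 'i%C * mu%:C%C) - 'i%C * mu%:C%C)
                           / mu%:C%C ^+ 2))].
Proof.
have [d' [T' [Q [V [z [VI Vf zV xz]]]]]] := x_PD.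
move=> H; pose k t := fine (gem_gap (seq_law V) (seq_law chi) t).
have HE : H = H_fun theta k.
  apply/funext => t; have [t0|t0] := leP t 0; first by rewrite /H !H_fun_le0.
  rewrite /H !H_fun_gt0// /k.
  by rewrite -(gap_probE Vf zV xz chi_uniform chi_indep x_chi_indep t0).
have mk : measurable_fun setT k.
  exact: (measurableT_comp (fine_measurable _) (measurable_gem_gap _ _)).
have k0 t : 0 <= k t by rewrite fine_ge0// gem_gap_ge0.
have k1 t : k t <= 1.
  by rewrite -lee_fin fineK ?gem_gap_fin_num// gem_gap_le1.
have k_rec := gem_gap_density_rec theta_gt0 VI Vf chi_indep chi_uniform.
have mH : measurable_fun setT H by rewrite HE; exact: measurable_H_fun.
have H0 t : 0 <= H t by rewrite HE H_fun_ge0.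
have Hneg t : t <= 0 -> H t = 0 by move=> t0; rewrite HE H_fun_le0.
have conv t : (t * H t)%:E =
    (theta%:E * \int[lebesgue_measure]_(y in `[0%R, 1%R]) ((1 - y) * H (t - y))%:E)%E.
  by rewrite HE; exact: H_fun_convolution.
have rconv t : (t * H t)%:E =
    (theta%:E * \int[lebesgue_measure]_y (ramp y * H (t - y))%:E)%E.
  by rewrite (integral_rampE (fun y => H (t - y))).
have Hloc N : 0 < N -> (\int[lebesgue_measure]_(t in `]0%R, N[) (H t)%:E < +oo)%E.
  move=> N0; rewrite HE; apply: H_fun_locally_integrable => //.
  exact: gem_density_integral (Vf).
have intH : lebesgue_measure.-integrable [set: R] (EFin \o H).
  exact: (integrable_H theta_gt0 mH H0 rconv Hneg Hloc).
have intM : lebesgue_measure.-integrable [set: R] (fun t => (t * H t)%:E).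
  exact: (integrable_moment theta_gt0 mH H0 rconv Hneg Hloc).
split=> // l.
(* an open interval (c, |l| + 1) around both 0 and l *)
pose c := - (`|l| + 1).
have c0 : c < 0 by rewrite oppr_lt0 ltr_wpDl.
have cl : c < l by have := ler_norm (- l); rewrite normrN /c; lra.
have lb : l < `|l| + 1 by have := ler_norm l; lra.
have zb : 0 < `|l| + 1 by rewrite ltr_wpDl.
pose P0 (y : R) := \int[lebesgue_measure]_(m in `[c, y]) cos_tr (@ramp R) m -
  \int[lebesgue_measure]_(m in `[c, 0]) cos_tr (@ramp R) m.
pose Q0 (y : R) := \int[lebesgue_measure]_(m in `[c, y]) sin_tr (@ramp R) m -
  \int[lebesgue_measure]_(m in `[c, 0]) sin_tr (@ramp R) m.
have dprim (f : R -> R) r y : continuous f -> c < y < `|l| + 1 ->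
    is_derive y 1 (fun y : R => \int[lebesgue_measure]_(m in `[c, y]) f m - r) (f y).
  move=> cf cy; have dy := is_derive_primitive cf cy.
  have := is_deriveB dy (is_derive_cst r y 1); rewrite subr0; exact.
have [||||||Al Sl] := @fourier_solution _ _ _ theta_gt0 mH H0 rconv intH intM P0 Q0 c
    (`|l| + 1) _ _ _ _ _ l.
- by rewrite /P0 subrr.
- by rewrite /Q0 subrr.
- by rewrite c0.
- by move=> y; apply: dprim; exact: continuous_cos_tr_ramp.
- by move=> y; apply: dprim; exact: continuous_sin_tr_ramp.
- by rewrite cl.
rewrite !fourierE// Al Sl (@Cintegral_oriented_levy _ l c (ltW c0) (ltW cl)).
have -> : - 'i%C * theta%:C%C * Complex (P0 l) (- Q0 l) =
    Complex (- (theta * Q0 l)) (- (theta * P0 l)).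
  by apply/eqP; rewrite eq_complex /=; apply/andP; split; apply/eqP; ring.
rewrite /expC /= cosN sinN.
by apply/eqP; rewrite eq_complex /=; apply/andP; split; apply/eqP; ring.
Qed.
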